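(* Let $A_i=\begin{pmatrix}a_i&b_i\\c_i&d_i\end{pmatrix}\in\mathbb{R}^{2\times2}$ with $\det A_i=1$ and $b_i>0$ ($i=1,2$). Let $f\in L^1(\mathbb{R}^2,\mathbb{H})$ and let $\mathcal{L}_R^{\mathbf{i},\mathbf{j}}(f)(u,v)=\int_{\mathbb{R}^2}f(s,t)K_{A_1}^{\mathbf{i}}(s,u)K_{A_2}^{\mathbf{j}}(t,v)\,ds\,dt$ be its right-sided quaternion linear canonical transform. If $\mathcal{L}_R^{\mathbf{i},\mathbf{j}}(f)\in L^1(\mathbb{R}^2,\mathbb{H})$, then $$f(s,t)=\int_{\mathbb{R}^2}\mathcal{L}_R^{\mathbf{i},\mathbf{j}}(f)(u,v)\,K_{A_2^{-1}}^{\mathbf{j}}(v,t)\,K_{A_1^{-1}}^{\mathbf{i}}(u,s)\,du\,dv$$ for almost every $(s,t)\in\mathbb{R}^2$.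
   Context: $\mathbb{H}$ is the algebra of quaternions $q=q_0+\mathbf{i}q_1+\mathbf{j}q_2+\mathbf{k}q_3$ ($q_n\in\mathbb{R}$) with the usual Hamilton multiplication ($\mathbf{i}\mathbf{j}=-\mathbf{j}\mathbf{i}=\mathbf{k}$, etc.) and modulus $|q|=(q_0^2+q_1^2+q_2^2+q_3^2)^{1/2}$; $e^{\mathbf{i}\theta}=\cos\theta+\mathbf{i}\sin\theta$ and likewise for $\mathbf{j}$. $L^1(\mathbb{R}^2,\mathbb{H})$ is the space of $f:\mathbb{R}^2\to\mathbb{H}$ with $\int_{\mathbb{R}^2}|f|\,ds\,dt<\infty$; integrals are taken componentwise. Kernels: for a real matrix $A=\begin{pmatrix}a&b\\c&d\end{pmatrix}$ with $\det A=1$, $b\neq0$, and $\mu\in\{\mathbf{i},\mathbf{j}\}$, $K_A^{\mu}(x,y)=\frac{1}{\sqrt{\mu2\pi b}}e^{\mu(\frac{a}{2b}x^2-\frac1bxy+\frac{d}{2b}y^2)}$, where $\sqrt{\mu2\pi b}=\sqrt{2\pi|b|}\,e^{\mu\,\mathrm{sgn}(b)\pi/4}$. Since $A^{-1}=\begin{pmatrix}d&-b\\-c&a\end{pmatrix}$, for $b>0$ one has $K_{A^{-1}}^{\mu}(y,x)=\frac{1}{\sqrt{-\mu2\pi b}}e^{\mu(-\frac{d}{2b}y^2+\frac1bxy-\frac{a}{2b}x^2)}$ with $\sqrt{-\mu2\pi b}=\sqrt{2\pi b}\,e^{-\mu\pi/4}$. *)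

(* Defs.v *)
From HB Require Import structures.
From mathcomp Require Import all_boot all_order all_algebra.
From mathcomp Require Import all_classical all_reals all_analysis.
From mathcomp Require Import measurable_realfun.
Set Implicit Arguments.
Unset Strict Implicit.
Unset Printing Implicit Defensive.
Import Order.TTheory GRing.Theory Num.Theory.
Import numFieldNormedType.Exports.
Local Open Scope classical_set_scope.
Local Open Scope ring_scope.

Record quaternion (R : realType) :=
  Quat { qre : R ; qi : R ; qj : R ; qk : R }.

Section Quaternions.
Variable R : realType.
Implicit Types p q mu : quaternion R.

Definition quat_i : quaternion R := Quat 0 1 0 0.
Definition quat_j : quaternion R := Quat 0 0 1 0.

Definition addq p q : quaternion R :=
  Quat (qre p + qre q) (qi p + qi q) (qj p + qj q) (qk p + qk q).

Definition scaleq (r : R) q : quaternion R :=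
  Quat (r * qre q) (r * qi q) (r * qj q) (r * qk q).

Definition mulq p q : quaternion R :=
  Quat (qre p * qre q - qi p * qi q - qj p * qj q - qk p * qk q)
       (qre p * qi q + qi p * qre q + qj p * qk q - qk p * qj q)
       (qre p * qj q - qi p * qk q + qj p * qre q + qk p * qi q)
       (qre p * qk q + qi p * qj q - qj p * qi q + qk p * qre q).

Definition normq q : R :=
  Num.sqrt (qre q ^+ 2 + qi q ^+ 2 + qj q ^+ 2 + qk q ^+ 2).

Definition conjq q : quaternion R :=
  Quat (qre q) (- qi q) (- qj q) (- qk q).

Definition invq q : quaternion R := scaleq (normq q ^- 2) (conjq q).

(* e^(mu theta), for mu an imaginary unit. *)
Definition expq mu (theta : R) : quaternion R :=
  addq (Quat (cos theta) 0 0 0) (scaleq (sin theta) mu).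

(* The branch of the square root of mu * 2 * pi * b fixed by
   sqrt(2 pi |b|) e^(mu sgn(b) pi/4). *)
Definition sqrt_mu2pi mu (b : R) : quaternion R :=
  scaleq (Num.sqrt (2 * pi * `|b|)) (expq mu (Num.sg b * (pi / 4))).

(* Meaningful only when A 0 1 != 0. *)
Definition lct_kernel mu (A : 'M[R]_2) (x y : R) : quaternion R :=
  let a := A 0 0 in let b := A 0 1 in let d := A 1 1 in
  mulq (invq (sqrt_mu2pi mu b))
       (expq mu (a / (2 * b) * x ^+ 2 - b^-1 * x * y + d / (2 * b) * y ^+ 2)).

End Quaternions.

Arguments quat_i {R}.
Arguments quat_j {R}.

Declare Scope quat_scope.
Delimit Scope quat_scope with quat.
Notation "p * q" := (mulq p q) : quat_scope.

(* Lebesgue measure on the Borel sets of R^2. *)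
Definition leb2 {R : realType} :
    {measure set (measurableTypeR R * measurableTypeR R) -> \bar R} :=
  (lebesgue_measure \x lebesgue_measure)%E.

Section Integration.
Variable R : realType.
Implicit Types f : R * R -> quaternion R.

(* Lebesgue (not just Borel) measurability: preimages of Borel sets lie in the
   completion of the Borel sigma-algebra of R^2. *)
Definition lebesgue_measurable2 (g : R * R -> R) : Prop :=
  forall B : set (measurableTypeR R), measurable B ->
    completed_algebra_gen (@leb2 R) (g @^-1` B).

(* [integral leb2] is a supremum over Borel simple functions, which on
   Lebesgue-measurable functions agrees with the integral for the completed
   measure. *)
Definition L1q f : Prop :=
  [/\ [/\ lebesgue_measurable2 (@qre R \o f),
          lebesgue_measurable2 (@qi R \o f),
          lebesgue_measurable2 (@qj R \o f) &
          lebesgue_measurable2 (@qk R \o f)] &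
      (\int[leb2]_p (normq (f p))%:E < +oo)%E].

Definition integralq f : quaternion R :=
  Quat (\int[leb2]_p qre (f p)) (\int[leb2]_p qi (f p))
       (\int[leb2]_p qj (f p)) (\int[leb2]_p qk (f p)).

Definition right_qlct (A1 A2 : 'M[R]_2) f (w : R * R) : quaternion R :=
  integralq (fun p => f p * lct_kernel quat_i A1 p.1 w.1
                          * lct_kernel quat_j A2 p.2 w.2)%quat.

End Integration.

(* Main.v *)
From Pilot Require Import Defs.
From mathcomp Require Import all_boot all_order all_algebra.
From mathcomp Require Import all_classical all_reals all_analysis.
From mathcomp Require Import measurable_realfun ring lra.
Set Implicit Arguments.
Unset Strict Implicit.
Unset Printing Implicit Defensive.
Import Order.TTheory GRing.Theory Num.Theory.
Import numFieldNormedType.Exports.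
Import Pilot.Defs.
Local Open Scope classical_set_scope.
Local Open Scope ring_scope.

(** The transform is inverted one variable at a time.  The kernels
    [exp(i theta)] and [exp(j theta')] do not commute, so no single scalar
    two-dimensional Fourier transform governs the situation; but by Fubini
    the transform is a composite [T2 (T1 f)], where [T1] multiplies by the
    i-kernel on the right and integrates over [s], and [T2] does the same
    with the j-kernel and [t].  For almost every [u] the section [L(u, .)] is
    integrable and is the one-variable j-transform of the integrable function
    [t |-> (T1 f)(u, t)], so one-variable inversion recovers [(T1 f)(u, t)]
    for almost every [t] as an integral [W(t, u)] of [L(u, .)].  Because [L]
    is integrable over the plane and the kernels are bounded, [W(t, .)] is
    integrable for every [t].  Hence, for almost every [t], the i-transform
    of [f(., t)] is integrable, and inverting it recovers [f(., t)].  This is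
    [iterated_inversion], which holds for all bounded kernels that admit a
    one-variable inversion.

    In one variable, right multiplication by [exp(i theta)] rotates the
    pairs (1, i) and (k, j) of real coordinates, and right multiplication by
    [exp(j theta)] rotates (1, j) and (i, k); so a one-variable transform is
    a pair of complex ones ([inversion_pair_chirpq_i],
    [inversion_pair_chirpq_j]).  The quadratic phase in the time variable is
    absorbed into the function and the one in the frequency variable cancels
    between the kernel and its inverse, which leaves the Fourier inversion
    theorem for an integrable function with integrable transform
    ([chirp_inversion]).

    That theorem, [fourier_inversion_cos_sin], is obtained by Abel
    summation.  The factor [exp(-e |u|)] makes all integrals absolutely
    convergent, and its transform is the Poisson kernel.  Integrating the
    regularised inverse over [[p, q]] turns the Poisson kernel into a
    difference of two arctangents, which is bounded and converges to a
    multiple of the indicator of [[p, q]] as [e] tends to 0.  So the inverse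
    transform and the original function have the same integral over every
    interval, and Lebesgue's differentiation theorem identifies them almost
    everywhere.

    The function [f] is only Lebesgue measurable.  It agrees off a null set
    with a Borel function all of whose horizontal sections are integrable
    ([borel_version]), and integrals are insensitive to null sets even for
    functions that are not Borel ([integral_off_null]). *)

(** * Null sets and integration on product spaces *)

Section AlmostEverywhere.
Context d (T : measurableType d) (R : realType).
Variable m : {measure set T -> \bar R}.
Implicit Types P Q S : T -> Prop.

Lemma ae_imply P Q : (forall x, P x -> Q x) ->
  {ae m, forall x, P x} -> {ae m, forall x, Q x}.
Proof. by move=> PQ; apply: filterS. Qed.

Lemma ae_imply2 P Q S : (forall x, P x -> Q x -> S x) ->
  {ae m, forall x, P x} -> {ae m, forall x, Q x} -> {ae m, forall x, S x}.
Proof. by move=> PQS; apply: filterS2. Qed.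

Lemma integrableM_bounded (f k : T -> R) C :
    m.-integrable setT (EFin \o f) -> measurable_fun setT k ->
    (forall x, `|k x| <= C) ->
  m.-integrable setT (EFin \o (fun x => f x * k x)).
Proof.
move=> intf mk kC.
have mf : measurable_fun setT f by exact/measurable_EFinP/(measurable_int m).
apply: le_integrable (integrableZl measurableT C intf) => //.
  by apply/measurable_EFinP; exact: measurable_funM.
move=> x _; rewrite lee_fin !normrM mulrC.
by rewrite ler_wpM2r// (le_trans (kC x))// ler_norm.
Qed.

End AlmostEverywhere.

Section NullSets.
Context d (T : measurableType d) (R : realType).
Variable m : {measure set T -> \bar R}.
Local Open Scope ereal_scope.
Import HBNNSimple.

(** The integral is a supremum over the simple functions below the integrand.
    Cutting such a simple function to zero on [N] keeps its integral and puts
    it below [g]; the argument applies to arbitrary nonnegative functions. *)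
Lemma ge0_le_integral_off_null (N : set T) (f g : T -> \bar R) :
    measurable N -> m N = 0 -> (forall x, 0 <= f x) -> (forall x, 0 <= g x) ->
    (forall x, ~ N x -> f x = g x) ->
  \int[m]_x f x <= \int[m]_x g x.
Proof.
move=> mN N0 f0 g0 fg; rewrite !ge0_integralTE//.
apply: ge_ereal_sup => _ [h hf <-].
pose h' := proj_nnsfun h (measurableC mN).
have -> : sintegral m h = sintegral m h'.
  rewrite -!integralT_nnsfun; apply: ge0_ae_eq_integral => //.
  - exact/measurable_EFinP.
  - exact/measurable_EFinP.
  - by move=> x _; rewrite lee_fin.
  - by move=> x _; rewrite lee_fin.
  exists N; split => // x /= hx; apply: contrapT => Nx; apply: hx => _.
  by rewrite /= /mindic indicE mem_set// mulr1.
apply: ereal_sup_ubound; exists h' => //= x.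
rewrite /mindic indicE; have [Nx|Nx] := pselect (N x).
  by rewrite memNset ?mulr0//; apply.
by rewrite mem_set// mulr1 -fg.
Qed.

Lemma integral_off_null (N : set T) (f g : T -> \bar R) :
    measurable N -> m N = 0 -> (forall x, ~ N x -> f x = g x) ->
  \int[m]_x f x = \int[m]_x g x.
Proof.
move=> mN N0 fg; rewrite [LHS]integralE [RHS]integralE.
by congr (_ - _); apply/eqP; rewrite eq_le; apply/andP; split;
  apply: (ge0_le_integral_off_null mN N0) => // x Nx;
  rewrite ?funeposE ?funenegE fg.
Qed.

Lemma Rintegral_off_null (N : set T) (f g : T -> R) :
    measurable N -> m N = 0 -> (forall x, ~ N x -> f x = g x) ->
  (\int[m]_x f x = \int[m]_x g x)%R.
Proof.
move=> mN N0 fg; congr fine.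
by apply: (integral_off_null mN N0) => x /fg ->.
Qed.

Lemma ae_Rintegral (f g : T -> R) :
    {ae m, forall x, f x = g x} -> (\int[m]_x f x = \int[m]_x g x)%R.
Proof.
move=> [N [mN N0 NP]]; apply: (Rintegral_off_null mN N0) => x Nx.
by apply: contrapT => fg; exact/Nx/NP.
Qed.

End NullSets.

Section DominatedConvergence.
Context d (T : measurableType d) (R : realType).
Variable m : {measure set T -> \bar R}.

Lemma cvg_Rintegral (f_ : nat -> T -> R) (f g : T -> R) :
    (forall n, measurable_fun setT (f_ n)) -> measurable_fun setT f ->
    {ae m, forall x, f_ n x @[n --> \oo] --> f x} ->
    m.-integrable setT (EFin \o g) -> (forall n x, `|f_ n x| <= g x) ->
  \int[m]_x f_ n x @[n --> \oo] --> \int[m]_x f x.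
Proof.
move=> mf_ mf ff ig fg.
have [] := @dominated_convergence _ _ _ m setT measurableT
  (fun n => EFin \o f_ n) (EFin \o f) (EFin \o g).
- by move=> n; exact/measurable_EFinP.
- exact/measurable_EFinP.
- apply: filterS ff => x fx _; apply: cvg_EFin => //; exact: nearW.
- exact: ig.
- by apply: aeW => x n _; rewrite /= lee_fin.
move=> if_ _ cf; rewrite /Rintegral; apply: fine_cvg.
by rewrite fineK//; exact: integrable_fin_num.
Qed.

End DominatedConvergence.

Section ProductMeasure.
Context d1 d2 (T1 : measurableType d1) (T2 : measurableType d2) (R : realType).
Variable m1 : {sigma_finite_measure set T1 -> \bar R}.
Variable m2 : {sigma_finite_measure set T2 -> \bar R}.
Implicit Types (h : T1 * T2 -> R) (D : set (T1 * T2)).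

(** Splitting into positive and negative parts reduces this to the Tonelli
    case; [fine] assigns a value to the infinite integrals as well. *)
Lemma measurable_Rintegral2 h : measurable_fun setT h ->
  measurable_fun setT (fun x => \int[m2]_y h (x, y)).
Proof.
move=> mh; have mEh : measurable_fun setT (EFin \o h) by exact/measurable_EFinP.
apply: measurableT_comp => //.
under eq_fun => x do rewrite integralE.
apply: emeasurable_funB.
- have H : measurable_fun setT (fubini_F m2 ((EFin \o h)^\+)%E).
    by apply: measurable_fun_fubini_tonelli_F; [exact: measurable_funepos|].
  apply: eq_measurable_fun H => x _; apply: eq_integral => y _.
  by rewrite ?funeposE ?funenegE.
- have H : measurable_fun setT (fubini_F m2 ((EFin \o h)^\-)%E).
    by apply: measurable_fun_fubini_tonelli_F; [exact: measurable_funeneg|].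
  apply: eq_measurable_fun H => x _; apply: eq_integral => y _.
  by rewrite ?funeposE ?funenegE.
Qed.

(** An integrable extended-real function is finite almost everywhere, so
    [fine] loses nothing.  It transfers Fubini's theorem to real-valued inner
    integrals, which are 0 on the null set of bad sections. *)
Lemma integral_fine d (T : measurableType d) (m : {measure set T -> \bar R})
    (F : T -> \bar R) : m.-integrable setT F ->
  fine (\int[m]_x F x)%E = \int[m]_x fine (F x).
Proof.
move=> iF; congr fine; apply: ae_eq_integral => //.
- exact: (measurable_int m).
- apply/measurable_EFinP; apply: measurableT_comp => //.
  exact: (measurable_int m).
have := integrable_ae measurableT iF.
by apply: filterS => x /(_ I) Fx _; rewrite fineK.
Qed.

Lemma Rintegral_prod12 h : (m1 \x m2)%E.-integrable setT (EFin \o h) ->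
  \int[(m1 \x m2)%E]_p h p = \int[m1]_x \int[m2]_y h (x, y).
Proof.
move=> ih; transitivity (fine (\int[m1]_x fubini_F m2 (EFin \o h) x)%E).
  by rewrite integral12_prod_meas1.
by rewrite (integral_fine (integrable_fubini_F ih)).
Qed.

Lemma integrable_fubini_G h : (m1 \x m2)%E.-integrable setT (EFin \o h) ->
  m2.-integrable setT (fubini_G m1 (EFin \o h)).
Proof.
move=> ih; have mG := measurable_fubini_G ih; apply/integrableP; split => //.
have mh := measurable_int _ ih.
apply: le_lt_trans ((integrable21ltyP _ _ mh).1 ih); apply: ge0_le_integral => //.
- exact: measurableT_comp.
- apply: (@measurable_fun_fubini_tonelli_G _ _ _ _ _ m1 (abse \o (EFin \o h))) => //=.
  exact: measurableT_comp.
- move=> y _; apply: le_abse_integral => //.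
  exact: (measurableT_comp mh).
Qed.

Lemma Rintegral_prod21 h : (m1 \x m2)%E.-integrable setT (EFin \o h) ->
  \int[(m1 \x m2)%E]_p h p = \int[m2]_y \int[m1]_x h (x, y).
Proof.
move=> ih; transitivity (fine (\int[m2]_y fubini_G m1 (EFin \o h) y)%E).
  by rewrite integral21_prod_meas1.
by rewrite (integral_fine (integrable_fubini_G ih)).
Qed.

Lemma integrable_fine d (T : measurableType d) (m : {measure set T -> \bar R})
    (F : T -> \bar R) : m.-integrable setT F ->
  m.-integrable setT (EFin \o (fun x => fine (F x))).
Proof.
move=> iF; apply: le_integrable (iF) => //.
  apply/measurable_EFinP; apply: measurableT_comp => //.
  exact: (measurable_int m).
by move=> x _ /=; case: (F x) => //= *; rewrite normr0 leey.
Qed.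

Lemma integrable_Rintegral2 h : (m1 \x m2)%E.-integrable setT (EFin \o h) ->
  m1.-integrable setT (EFin \o (fun x => \int[m2]_y h (x, y))).
Proof. by move=> ih; exact: (integrable_fine (integrable_fubini_F ih)). Qed.

Lemma integrable_Rintegral1 h : (m1 \x m2)%E.-integrable setT (EFin \o h) ->
  m2.-integrable setT (EFin \o (fun y => \int[m1]_x h (x, y))).
Proof. by move=> ih; exact: (integrable_fine (integrable_fubini_G ih)). Qed.

Lemma Rintegral_swap h : (m1 \x m2)%E.-integrable setT (EFin \o h) ->
  \int[m1]_x \int[m2]_y h (x, y) = \int[m2]_y \int[m1]_x h (x, y).
Proof. by move=> ih; rewrite -Rintegral_prod12// Rintegral_prod21. Qed.

Lemma prod_ae12 D : measurable D -> {ae (m1 \x m2)%E, forall p, D p} ->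
  {ae m1, forall x, {ae m2, forall y, D (x, y)}}.
Proof.
move=> mD /(negligibleP _ (measurableC mD)) D0; have mCD := measurableC mD.
have /ae_eq_integral_abs : 
  (\int[m1]_x `|(m2 \o xsection (~` D)) x| = 0)%E.
  by rewrite -[RHS]D0; apply: eq_integral => x _; rewrite gee0_abs.
move=> /(_ measurableT (measurable_fun_xsection _ mCD)).
apply: filterS => x /(_ I) /= Dx.
have /negligibleP := Dx => /(_ (measurable_xsection _ mCD)).
by apply: negligibleS => y /= nD; rewrite /xsection/= inE.
Qed.

Lemma product_measure1_ysection D : measurable D ->
  (m1 \x m2)%E D = (\int[m2]_y (m1 \o ysection D) y)%E.
Proof.
move=> mD; have := @product_measure_unique _ _ _ _ _ m1 m2 (m1 \x^ m2)%E.
by apply => // A B mA mB; rewrite /= product_measure2E.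
Qed.

Lemma ae_prod21 D : measurable D ->
    {ae m2, forall y, {ae m1, forall x, D (x, y)}} ->
  {ae (m1 \x m2)%E, forall p, D p}.
Proof.
move=> mD aeD; have mCD := measurableC mD.
apply/negligibleP; first exact: mCD.
transitivity (\int[m2]_y (m1 \o ysection (~` D)) y)%E.
  exact: product_measure1_ysection.
rewrite -(integral0 m2 setT); apply: ae_eq_integral => //.
  exact: measurable_fun_ysection.
apply: filterS aeD => y aey _ /=; apply/negligibleP.
  exact: measurable_ysection.
by apply: negligibleS aey => x; rewrite /ysection/= inE.
Qed.

Lemma integrable_prod_bounded (a : T1 -> R) (b : T2 -> R) (k : T1 * T2 -> R) C :
    m1.-integrable setT (EFin \o a) -> m2.-integrable setT (EFin \o b) ->
    measurable_fun setT k -> (forall p, `|k p| <= C) ->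
  (m1 \x m2)%E.-integrable setT (EFin \o (fun p => a p.1 * b p.2 * k p)).
Proof.
move=> ia ib mk kC.
have ma : measurable_fun setT a by exact/measurable_EFinP/(measurable_int m1).
have mb : measurable_fun setT b by exact/measurable_EFinP/(measurable_int m2).
have mab : measurable_fun setT (fun p : T1 * T2 => a p.1 * b p.2).
  by apply: measurable_funM; apply: measurableT_comp.
have iab : (m1 \x m2)%E.-integrable setT (EFin \o (fun p => a p.1 * b p.2)).
  apply/integrable12ltyP; first exact/measurable_EFinP.
  have /integrableP[mEa a_fin] := ia; have /integrableP[mEb b_fin] := ib.
  rewrite [ltLHS](_ : _ =
      (\int[m1]_x `|(a x)%:E| * \int[m2]_y `|(b y)%:E|)%E); last first.
    rewrite -ge0_integralZr//=.
    - apply: eq_integral => x _; rewrite -ge0_integralZl//=.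
      + by apply: eq_integral => y _; rewrite normrM EFinM.
      + exact: (measurableT_comp (@abse_measurable R setT) mEb).
    - exact: (measurableT_comp (@abse_measurable R setT) mEa).
    - exact: integral_ge0.
  by apply: lte_mul_pinfty => //; [exact: integral_ge0|rewrite ge0_fin_numE//; exact: integral_ge0].
exact: (integrableM_bounded iab mk kC).
Qed.

End ProductMeasure.

(** * The transform of exp(-e|u|) is the Poisson kernel *)

Section AbelKernel.
Variable R : realType.
Local Notation mu := (@lebesgue_measure R).
Implicit Types e w u : R.

Let abel_primitive e w u := expR (- (e * u)) *
  ((w * sin (w * u) - e * cos (w * u)) / (e ^+ 2 + w ^+ 2) - e^-1).

Let is_derive_abel_primitive e w u : 0 < e ->
  is_derive u (1 : R) (abel_primitive e w) (expR (- (e * u)) * (1 + cos (w * u))).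
Proof.
move=> e0; apply: is_derive_eq; rewrite /GRing.scale/=.
have ew : e ^+ 2 + w ^+ 2 != 0 by rewrite gt_eqF// ltr_pwDl ?exprn_gt0// sqr_ge0.
by field; rewrite ew gt_eqF.
Qed.

Let abel_primitive_cvg e w : 0 < e ->
  abel_primitive e w u @[u --> +oo] --> 0.
Proof.
move=> e0; pose M := (`|w| + e) / (e ^+ 2 + w ^+ 2) + e^-1.
have ew : 0 < e ^+ 2 + w ^+ 2 by rewrite ltr_pwDl ?exprn_gt0// sqr_ge0.
have bound u : `|abel_primitive e w u| <= M * expR (- (e * u)).
  rewrite normrM ger0_norm ?expR_ge0// mulrC ler_wpM2r ?expR_ge0//.
  rewrite (le_trans (ler_normB _ _))// lerD//; last by rewrite gtr0_norm ?invr_gt0.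
  rewrite normrM [X in _ * X]gtr0_norm ?invr_gt0// ler_wpM2r ?invr_ge0 ?(ltW ew)//.
  rewrite (le_trans (ler_normB _ _))// lerD//.
    by rewrite normrM ler_piMr// sin_max.
  by rewrite normrM gtr0_norm// ler_piMr ?(ltW e0)// cos_max.
have cvgM : M * expR (- (e * u)) @[u --> +oo] --> 0.
  rewrite -[X in _ --> X](mulr0 M); apply: cvgM; first exact: cvg_cst.
  apply: (@cvg_comp _ _ _ ( *%R e) (fun x => expR (- x)) _ (+oo%R)); last exact: cvgr_expR.
  exact: gt0_cvgMry.
apply: (@squeeze_cvgr _ _ _ _ (fun u => - (M * expR (- (e * u))))
   (fun u => M * expR (- (e * u)))) => //.
  by apply: nearW => u; rewrite -ler_norml.
by rewrite -oppr0; apply: cvgN.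
Qed.

(** Adding 1 to the cosine makes the integrand nonnegative, which is what the
    fundamental theorem of calculus on a half-line asks for.  The choice
    [w = 0] gives the integral of [expR (- (e * u))] itself. *)
Lemma half_abel_integral e w : 0 < e ->
  (\int[mu]_(u in `[0%R, +oo[) (expR (- (e * u)) * (1 + cos (w * u)))%:E =
    (e / (e ^+ 2 + w ^+ 2) + e^-1)%:E)%E.
Proof.
move=> e0.
rewrite (@ge0_continuous_FTC2y _ _ (abel_primitive e w) _ 0).
- rewrite /abel_primitive -EFinB; congr EFin.
  by rewrite !mulr0 oppr0 expR0 sin0 cos0; ring.
- by move=> u _; rewrite mulr_ge0 ?expR_ge0// -lerBlDl sub0r cos_geN1.
- apply: continuous_subspaceT => u; apply: cvgM.
    apply: continuous_comp; last exact: continuous_expR.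
    by apply: cvgN; apply: cvgM; [exact: cvg_cst|exact: cvg_id].
  apply: cvgD; first exact: cvg_cst.
  apply: continuous_comp; last exact: continuous_cos.
  by apply: cvgM; [exact: cvg_cst|exact: cvg_id].
- exact: abel_primitive_cvg.
- by move=> u _; apply: ex_derive; apply: is_derive_abel_primitive.
- apply: cvg_at_right_filter; apply: differentiable_continuous.
  by apply/derivable1_diffP; apply: ex_derive; apply: is_derive_abel_primitive.
- move=> u _; rewrite derive1E.
  by apply: derive_val; apply: is_derive_abel_primitive.
Qed.

End AbelKernel.

Section AbelTransform.
Variable R : realType.
Local Notation mu := (@lebesgue_measure R).
Implicit Types (f : R -> R) (e w u : R).

(** Folding the line at the origin removes the absolute value from
    [exp(-e |u|)], so that the half-line computation applies. *)
Lemma ge0_integral_fold f : (forall u, 0 <= f u) -> continuous f ->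
  (\int[mu]_u (f u)%:E = \int[mu]_(u in `[0%R, +oo[) (f u + f (- u))%:E)%E.
Proof.
move=> f0 cf; have mf : measurable_fun [set: R] f by exact: continuous_measurable_fun.
have cfN : continuous (f \o -%R).
  by move=> u; apply: continuous_comp; [exact: opp_continuous|exact: cf].
have mfN : measurable_fun [set: R] (f \o -%R) by exact: continuous_measurable_fun.
have mpos : measurable [set x : R | 0 <= x] by rewrite -set_itvcy.
rewrite -(setUv [set x : R | 0 <= x]) ge0_integral_setU//= ; last 4 first.
  exact: measurableC.
  by apply/measurable_EFinP; rewrite setUv.
  by move=> x _; rewrite lee_fin.
  exact/disj_setPCl.
rewrite -set_itvcy// setCitvr.
rewrite integral_itv_bndo_bndc; last exact/measurable_EFinP/measurable_funTS.
rewrite -{2}oppr0 ge0_integration_by_substitutionNy//; last exact: continuous_subspaceT.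
rewrite -ge0_integralD//=.
- by move=> u _; rewrite lee_fin.
- exact/measurable_EFinP/measurable_funTS.
- by move=> u _; rewrite lee_fin.
- exact/measurable_EFinP/measurable_funTS.
Qed.

(** The Abel summation factor. *)
Definition abel e u := expR (- (e * `|u|)).

Lemma continuous_abel e : continuous (abel e).
Proof.
move=> u; apply: continuous_comp; last exact: continuous_expR.
by apply: cvgN; apply: cvgM; [exact: cvg_cst|exact: norm_continuous].
Qed.

Lemma abel_ge0 e u : 0 <= abel e u. Proof. exact: expR_ge0. Qed.

Lemma abel_le1 e u : 0 < e -> abel e u <= 1.
Proof. by move=> e0; rewrite -expR0 ler_expR oppr_le0 mulr_ge0// ltW. Qed.

Lemma continuous_sinM w : continuous (fun u => sin (w * u)).
Proof.
move=> u; apply: continuous_comp; last exact: continuous_sin.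
by apply: cvgM; [exact: cvg_cst|exact: cvg_id].
Qed.

Lemma continuous_cosM w : continuous (fun u => cos (w * u)).
Proof.
move=> u; apply: continuous_comp; last exact: continuous_cos.
by apply: cvgM; [exact: cvg_cst|exact: cvg_id].
Qed.

Let integral_abel_1cos e w : 0 < e ->
  (\int[mu]_u (abel e u * (1 + cos (w * u)))%:E =
   (2 * (e / (e ^+ 2 + w ^+ 2) + e^-1))%:E)%E.
Proof.
move=> e0; rewrite ge0_integral_fold.
- rewrite EFinM -half_abel_integral// -ge0_integralZl_EFin//.
  + apply: eq_integral => u; rewrite inE/= in_itv/= andbT => u0.
    by rewrite -EFinM /abel normrN ger0_norm// mulrN cosN; congr EFin; ring.
  + apply/measurable_EFinP/measurable_funTS; apply: continuous_measurable_fun => u.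
    apply: cvgM.
      apply: continuous_comp; last exact: continuous_expR.
      by apply: cvgN; apply: cvgM; [exact: cvg_cst|exact: cvg_id].
    by apply: cvgD; [exact: cvg_cst|exact: continuous_cosM].
- by move=> u; rewrite mulr_ge0 ?abel_ge0// -lerBlDl sub0r cos_geN1.
- move=> u; apply: cvgM; first exact: continuous_abel.
  by apply: cvgD; [exact: cvg_cst|exact: continuous_cosM].
Qed.

Lemma integral_abel e : 0 < e -> (\int[mu]_u (abel e u)%:E = (2 / e)%:E)%E.
Proof.
move=> e0; have := integral_abel_1cos 0 e0.
under eq_integral do rewrite mul0r cos0 mulrC EFinM.
rewrite ge0_integralZl_EFin//; last 2 first.
- by move=> u _; rewrite lee_fin abel_ge0.
- by apply/measurable_EFinP; apply: continuous_measurable_fun; exact: continuous_abel.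
move=> /(congr1 (fun x => 2^-1%:E * x)%E); rewrite muleA -EFinM mulVf// mul1e => ->.
rewrite -EFinM; congr EFin; field; exact: lt0r_neq0.
Qed.

Lemma integrable_abel e : 0 < e -> mu.-integrable setT (EFin \o abel e).
Proof.
move=> e0; apply/integrableP; split.
  by apply/measurable_EFinP; apply: continuous_measurable_fun; exact: continuous_abel.
under eq_integral do rewrite /= ger0_norm ?abel_ge0//.
by rewrite integral_abel// ltry.
Qed.

Lemma integrable_abelM e (k : R -> R) : 0 < e -> measurable_fun setT k ->
  (forall u, `|k u| <= 1) -> mu.-integrable setT (EFin \o (fun u => abel e u * k u)).
Proof.
move=> e0 mk k1; apply: le_integrable (integrable_abel e0) => //.
  apply/measurable_EFinP; apply: measurable_funM => //.
  by apply: continuous_measurable_fun; exact: continuous_abel.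
by move=> u _; rewrite lee_fin normrM ler_piMr.
Qed.

(** Undoes the addition of 1 that made the integrands nonnegative. *)
Let Rintegral_abel1D e (k : R -> R) (c : R) : 0 < e -> measurable_fun setT k ->
  (forall u, `|k u| <= 1) -> 
  (\int[mu]_u (abel e u * (1 + k u))%:E = c%:E)%E ->
  \int[mu]_u (abel e u * k u) = c - 2 / e.
Proof.
move=> e0 mk k1 cE; rewrite -[c]/(fine c%:E) -cE.
have -> : 2 / e = \int[mu]_u abel e u by rewrite /Rintegral integral_abel.
under [in RHS]eq_integral do rewrite mulrDr mulr1.
rewrite -/(Rintegral _ _ _) RintegralD//; last 2 first.
- exact: integrable_abel.
- exact: integrable_abelM.
by rewrite addrC addKr.
Qed.

Lemma Rintegral_abel_cos e w : 0 < e ->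
  \int[mu]_u (abel e u * cos (w * u)) = 2 * e / (e ^+ 2 + w ^+ 2).
Proof.
move=> e0; rewrite (Rintegral_abel1D e0 _ _ (integral_abel_1cos w e0)).
- by ring.
- by apply: continuous_measurable_fun; exact: continuous_cosM.
- by move=> u; exact: cos_max.
Qed.

Lemma Rintegral_abel_sin e w : 0 < e -> \int[mu]_u (abel e u * sin (w * u)) = 0.
Proof.
move=> e0; rewrite (@Rintegral_abel1D _ _ (2 / e) e0) ?subrr//.
- by apply: continuous_measurable_fun; exact: continuous_sinM.
- by move=> u; exact: sin_max.
rewrite -integral_abel// !ge0_integral_fold.
- apply: eq_integral => u _; rewrite mulrN sinN /abel normrN; congr EFin; ring.
- by move=> u; rewrite mulr_ge0 ?abel_ge0// -lerBlDl sub0r sin_geN1.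
- move=> u; apply: cvgM; first exact: continuous_abel.
  by apply: cvgD; [exact: cvg_cst|exact: continuous_sinM].
- by move=> u; exact: abel_ge0.
- exact: continuous_abel.
Qed.

End AbelTransform.

(** * Fourier inversion on the line *)

Section TrigMeasurability.
Context d (T : measurableType d) (R : realType).
Implicit Types f : T -> R.

Lemma measurable_cos f :
  measurable_fun setT f -> measurable_fun setT (fun x => cos (f x)).
Proof.
move=> mf; apply: measurableT_comp => //.
by apply: continuous_measurable_fun; exact: continuous_cos.
Qed.

Lemma measurable_sin f :
  measurable_fun setT f -> measurable_fun setT (fun x => sin (f x)).
Proof.
move=> mf; apply: measurableT_comp => //.
by apply: continuous_measurable_fun; exact: continuous_sin.
Qed.

Lemma measurable_atan f :
  measurable_fun setT f -> measurable_fun setT (fun x => atan (f x)).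
Proof.
move=> mf; apply: measurableT_comp => //.
by apply: continuous_measurable_fun => x; exact: continuous_atan.
Qed.

End TrigMeasurability.

Lemma measurable_abel (R : realType) (e : R) : measurable_fun setT (abel e).
Proof. by apply: continuous_measurable_fun; exact: continuous_abel. Qed.

Ltac mfun := repeat first
  [ assumption | exact: measurable_abel | exact: measurable_cst
  | exact: measurable_id | exact: measurable_fst | exact: measurable_snd
  | apply: measurable_cos | apply: measurable_sin | apply: measurable_atan
  | apply: measurable_funD | apply: measurable_funB | apply: measurable_funM
  | apply: measurable_funN | apply: measurableT_comp ].

Section FourierInversion.
Variable R : realType.
Local Notation mu := (@lebesgue_measure R).

(** At a Lebesgue point the value of [k] is the limit of its means over
    shrinking centred intervals, and all those means vanish. *)
Lemma ae_eq0_of_itv_integral0 (k : R -> R) :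
    locally_integrable setT k ->
    (forall p q, p < q -> (\int[mu]_(x in `[p, q]) (k x)%:E = 0)%E) ->
  {ae mu, forall x, k x = 0}.
Proof.
move=> lk k0; apply: ae_imply (lebesgue_differentiation lk) => x kx.
pose E (x : R) n := `[x - n.+1%:R^-1, x + n.+1%:R^-1]%classic.
have EE (y : R) n : mu (E y n) = (2 * n.+1%:R^-1)%:E.
  rewrite /E lebesgue_measure_itv/= lte_fin ltrD2l gtrN//.
  by rewrite -EFinB; congr EFin; ring.
have nE (y : R) : nicely_shrinking y (E y).
  split; first by move=> n; exact: measurable_itv.
  exists (2, fun n => (2 / n.+1%:R)%:pos); split => //=.
  - rewrite -[X in _ --> X](mulr0 2); apply: cvgM; first exact: cvg_cst.
    exact: cvg_harmonic.
  - move=> n z; rewrite /E/= in_itv/= /ball/= => zE.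
    rewrite distrC (@le_lt_trans _ _ n.+1%:R^-1)//; first by rewrite ler_distl.
    by rewrite ltr_pMl ?invr_gt0// ltr1n.
  - move=> n; rewrite lebesgue_measure_ball// EE lee_fin.
    by rewrite -[leLHS]mulr_natl.
have := nice_lebesgue_differentiation nE lk kx.
have xn n : x - n.+1%:R^-1 < x + n.+1%:R^-1 by rewrite ltrD2l gtrN.
under eq_fun do rewrite /E k0// mule0.
by move=> /(cvg_lim (@ereal_hausdorff R)); rewrite lim_cst// => -[].
Qed.

Section WaveTransform.
Variables (b : R) (g1 g2 : R -> R).

(** With [g = g1 + i g2], this is the real part of
    [g(y) exp(- i b (y - s) u)].  Its integral over [y] is, up to a
    constant, the real part of the integrand at frequency [u] of the inverse
    Fourier transform evaluated at [s]. *)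
Definition wave s u y : R := g1 y * cos (b * (y - s) * u) + g2 y * sin (b * (y - s) * u).

Definition wave_transform s u : R := \int[mu]_y wave s u y.

Hypotheses (mg1 : measurable_fun setT g1) (mg2 : measurable_fun setT g2).

Lemma measurable_wave_transform : measurable_fun setT (fun q : R * R => wave_transform q.1 q.2).
Proof.
have mwave : measurable_fun setT (fun p : (R * R) * R => wave p.1.1 p.1.2 p.2).
  by rewrite /wave; mfun.
exact: (measurable_Rintegral2 mu mwave).
Qed.

End WaveTransform.

Section AbelSummation.
Variables (b : R) (g1 g2 : R -> R).
Hypothesis b0 : 0 < b.
Hypotheses (ig1 : mu.-integrable setT (EFin \o g1))
           (ig2 : mu.-integrable setT (EFin \o g2)).

Let mg1 : measurable_fun setT g1.
Proof. apply/measurable_EFinP; exact: (measurable_int mu ig1). Qed.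

Let mg2 : measurable_fun setT g2.
Proof. apply/measurable_EFinP; exact: (measurable_int mu ig2). Qed.

Local Notation wave := (wave b g1 g2).
Local Notation wave_transform := (wave_transform b g1 g2).
Local Notation measurable_wave_transform := (measurable_wave_transform b mg1 mg2).

Let integrable_wave s u : mu.-integrable setT (EFin \o wave s u).
Proof.
have ig : mu.-integrable setT (EFin \o (fun y => `|g1 y| + `|g2 y|)).
  exact: (integrableD measurableT (integrable_norm ig1) (integrable_norm ig2)).
apply: le_integrable ig => //.
  by apply/measurable_EFinP; rewrite /wave; mfun.
move=> y _; rewrite lee_fin [leRHS]ger0_norm ?addr_ge0//.
by rewrite (le_trans (ler_normD _ _))// lerD// normrM ler_piMr// ?cos_max ?sin_max.
Qed.

Definition poisson e x : R := 2 * e / (e ^+ 2 + (b * x) ^+ 2).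

Let poisson_bound e x : 0 < e -> `|poisson e x| <= 2 / e.
Proof.
move=> e0; have D0 : 0 < e ^+ 2 + (b * x) ^+ 2.
  by rewrite ltr_pwDl ?exprn_gt0// sqr_ge0.
rewrite /poisson ger0_norm; last by rewrite divr_ge0 ?mulr_ge0// ltW.
rewrite ler_pdivrMr//.
have -> : 2 / e * (e ^+ 2 + (b * x) ^+ 2) = 2 * e + 2 / e * (b * x) ^+ 2.
  by field; rewrite gt_eqF.
by rewrite lerDl mulr_ge0 ?sqr_ge0// divr_ge0// ltW.
Qed.

Let continuous_poisson e : 0 < e -> continuous (poisson e).
Proof.
move=> e0 x; apply: cvgM; first exact: cvg_cst.
apply: cvgV; first by rewrite gt_eqF// ltr_pwDl ?exprn_gt0// sqr_ge0.
apply: cvgD; first exact: cvg_cst.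
by apply: cvgM; (apply: cvgM; [exact: cvg_cst|exact: cvg_id]).
Qed.

Let measurable_poisson e : 0 < e -> measurable_fun setT (poisson e).
Proof. by move=> e0; apply: continuous_measurable_fun; exact: continuous_poisson. Qed.

(** Fubini, legitimate thanks to the Abel factor.  The sine part integrates to
    zero by parity and the cosine part gives the Poisson kernel. *)
Let integral_wave_abel e s : 0 < e ->
  \int[mu]_u (wave_transform s u * abel e u) = \int[mu]_y (g1 y * poisson e (y - s)).
Proof.
move=> e0.
transitivity (\int[mu]_u \int[mu]_y
    (abel e u * g1 y * cos (b * (y - s) * u) +
     abel e u * g2 y * sin (b * (y - s) * u))).
  apply: eq_Rintegral => u _; rewrite /wave_transform.
  rewrite -(@RintegralZr _ _ _ mu _ _ _ measurableT (integrable_wave s u)).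
  by apply: eq_Rintegral => y _; rewrite /wave; ring.
have H1 : (mu \x mu)%E.-integrable setT
    (EFin \o (fun p => abel e p.1 * g1 p.2 * cos (b * (p.2 - s) * p.1))).
  apply: (integrable_prod_bounded (C := 1) (integrable_abel e0) ig1); first by mfun.
  by move=> p; exact: cos_max.
have H2 : (mu \x mu)%E.-integrable setT
    (EFin \o (fun p => abel e p.1 * g2 p.2 * sin (b * (p.2 - s) * p.1))).
  apply: (integrable_prod_bounded (C := 1) (integrable_abel e0) ig2); first by mfun.
  by move=> p; exact: sin_max.
have H : (mu \x mu)%E.-integrable setT
    (EFin \o (fun p => abel e p.1 * g1 p.2 * cos (b * (p.2 - s) * p.1) +
                       abel e p.1 * g2 p.2 * sin (b * (p.2 - s) * p.1))).
  exact: (integrableD measurableT H1 H2).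
rewrite (Rintegral_swap H); apply: eq_Rintegral => y _ /=.
have icos : mu.-integrable setT (EFin \o (fun u => abel e u * cos (b * (y - s) * u))).
  by apply: integrable_abelM => //; [mfun|move=> u; exact: cos_max].
have isin : mu.-integrable setT (EFin \o (fun u => abel e u * sin (b * (y - s) * u))).
  by apply: integrable_abelM => //; [mfun|move=> u; exact: sin_max].
transitivity (\int[mu]_u (g1 y * (abel e u * cos (b * (y - s) * u)) +
                          g2 y * (abel e u * sin (b * (y - s) * u)))).
  by apply: eq_Rintegral => u _; ring.
rewrite RintegralD//; last 2 first.
- exact: (integrableZl measurableT (g1 y) icos).
- exact: (integrableZl measurableT (g2 y) isin).
by rewrite !RintegralZl// Rintegral_abel_cos// Rintegral_abel_sin// mulr0 addr0.
Qed.

Let Rintegral_itv_indic (p q : R) (k : R -> R) :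
  \int[mu]_(s in `[p, q]) k s = \int[mu]_s (\1_`[p, q]%classic s * k s).
Proof.
rewrite Rintegral_mkcond; apply: eq_Rintegral => s _.
by rewrite patchE indicE; case: ifP => _ /=; rewrite ?mul1r ?mul0r.
Qed.

Let integral_poisson_itv e p q y : 0 < e -> p < q ->
  \int[mu]_s (\1_`[p, q]%classic s * poisson e (y - s)) =
  2 / b * (atan (b * (y - p) / e) - atan (b * (y - q) / e)).
Proof.
move=> e0 pq; rewrite -Rintegral_itv_indic.
(* A primitive in [s] of the translated Poisson kernel. *)
pose F (s : R) := - (2 / b * atan (b * (y - s) / e)).
have dF (s : R) : is_derive s (1 : R) F (poisson e (y - s)).
  apply: is_derive_eq; rewrite /GRing.scale/= /poisson.
  have D0 : e ^+ 2 + (b * (y - s)) ^+ 2 != 0.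
    by rewrite gt_eqF// ltr_pwDl ?exprn_gt0// sqr_ge0.
  have D1 : 1 + (b * (y - s) / e) ^+ 2 != 0.
    by rewrite gt_eqF// ltr_pwDl ?ltr01// sqr_ge0.
  by field; rewrite D0 !gt_eqF.
have cF (s : R) : {for s, continuous F}.
  by apply: differentiable_continuous; apply/derivable1_diffP; apply: ex_derive.
rewrite /Rintegral (@continuous_FTC2 _ _ F p q pq).
- by rewrite /F -EFinB /=; ring.
- apply: continuous_subspaceT => s.
  apply: (@continuous_comp _ _ _ (fun s => y - s) (poisson e));
    last exact: continuous_poisson.
  by apply: cvgB; [exact: cvg_cst|exact: cvg_id].
- split.
  + by move=> s _; apply: ex_derive.
  + by apply: cvg_at_right_filter; exact: cF.
  + by apply: cvg_at_left_filter; exact: cF.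
- by move=> s _; rewrite derive1E; apply: derive_val.
Qed.

Let integral_itv_wave_abel e p q : 0 < e -> p < q ->
  \int[mu]_s (\1_`[p, q]%classic s * \int[mu]_u (wave_transform s u * abel e u)) =
  \int[mu]_y (g1 y *
     (2 / b * (atan (b * (y - p) / e) - atan (b * (y - q) / e)))).
Proof.
move=> e0 pq.
have mpoisson : measurable_fun setT (fun z : R * R => poisson e (z.2 - z.1)).
  by apply: (measurableT_comp (measurable_poisson e0)); mfun.
have H : (mu \x mu)%E.-integrable setT (EFin \o
    (fun z => \1_`[p, q]%classic z.1 * g1 z.2 * poisson e (z.2 - z.1))).
  have iI : mu.-integrable setT (EFin \o (\1_`[p, q]%classic : R -> R)).
    exact: integrable_indic_itv.
  apply: (integrable_prod_bounded (C := 2 / e) iI ig1 mpoisson).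
  by move=> z; exact: poisson_bound.
transitivity (\int[mu]_s \int[mu]_y
    (\1_`[p, q]%classic s * g1 y * poisson e (y - s))).
  apply: eq_Rintegral => s _; rewrite integral_wave_abel// -RintegralZl//.
    by apply: eq_Rintegral => y _; rewrite mulrA.
  apply: (integrableM_bounded (C := 2 / e) ig1) => [|y]; last exact: poisson_bound.
  by apply: (measurableT_comp (measurable_poisson e0)); mfun.
rewrite (Rintegral_swap H); apply: eq_Rintegral => y _ /=.
rewrite -integral_poisson_itv// -RintegralZl//.
  by apply: eq_Rintegral => s _; ring.
apply: (integrableM_bounded (C := 2 / e)) => [||s].
- exact: integrable_indic_itv.
- by apply: (measurableT_comp (measurable_poisson e0)); mfun.
- exact: poisson_bound.
Qed.

Let cvg_atan_harmonic (c : R) : c != 0 ->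
  atan (c / n.+1%:R^-1) @[n --> \oo] --> Num.sg c * (pi / 2).
Proof.
have pos (r : R) : 0 < r -> atan (r / n.+1%:R^-1) @[n --> \oo] --> pi / 2.
  move=> r0; have rn : r / n.+1%:R^-1 @[n --> \oo] --> +oo.
    apply/cvgryPge => M; near=> n.
    rewrite invrK -ler_pdivrMl// (@le_trans _ _ n%:R) ?ler_nat//.
    by near: n; exact: nbhs_infty_ger.
  apply: (@cvg_comp _ _ _ (fun n => r / n.+1%:R^-1) atan _ (+oo%R)).
    exact: rn.
  exact: cvgy_atan.
move=> c0; have [cp|cn|] := ltgtP c 0; last by move/eqP; rewrite (negbTE c0).
  rewrite ltr0_sg// mulN1r -[c]opprK; under eq_fun do rewrite mulNr atanN.
  by apply: cvgN; apply: pos; rewrite oppr_gt0.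
by rewrite gtr0_sg// mul1r; exact: pos.
Unshelve. all: by end_near. Qed.

(** The endpoints [p] and [q] have to be excluded: there the limit is half the
    value required. *)
Let cvg_atan_itv (p q y : R) : p < q -> y != p -> y != q ->
  2 / b * (atan (b * (y - p) / n.+1%:R^-1) - atan (b * (y - q) / n.+1%:R^-1))
    @[n --> \oo] --> 2 * pi / b * \1_`[p, q]%classic y.
Proof.
move=> pq yp yq.
have H z : y != z -> atan (b * (y - z) / n.+1%:R^-1) @[n --> \oo] -->
    Num.sg (y - z) * (pi / 2).
  move=> yz; have := @cvg_atan_harmonic (b * (y - z)).
  rewrite sgrM (gtr0_sg b0) mul1r; apply.
  by rewrite mulf_neq0 ?subr_eq0// gt_eqF.
have -> : 2 * pi / b * \1_`[p, q]%classic y =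
    2 / b * (Num.sg (y - p) * (pi / 2) - Num.sg (y - q) * (pi / 2)).
  rewrite indicE; have [yp'|yp'] := ltP y p.
    have yq' := lt_trans yp' pq.
    rewrite memNset/= ?in_itv/= ?(lt_geF yp')//.
    by rewrite !ltr0_sg ?subr_lt0//; ring.
  have [yq'|yq'] := leP y q.
    have -> : Num.sg (y - p) = 1.
      by rewrite gtr0_sg// subr_gt0 lt_neqAle yp' eq_sym yp.
    have -> : Num.sg (y - q) = -1 by rewrite ltr0_sg// subr_lt0 lt_neqAle yq yq'.
    rewrite mem_set/= ?in_itv/= ?yp'//.
    by field; rewrite gt_eqF.
  rewrite memNset/= ?in_itv/= ?(lt_geF yq') ?andbF//.
  by rewrite !gtr0_sg ?subr_gt0//; [ring|exact: lt_trans yq'].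
by apply: cvgM; [exact: cvg_cst|apply: cvgB; exact: H].
Qed.

Let cvg_abel_harmonic (u : R) : abel n.+1%:R^-1 u @[n --> \oo] --> (1 : R).
Proof.
rewrite -[X in _ --> X]expR0 -[in X in _ --> X]oppr0.
apply: (continuous_cvg _ (@continuous_expR R _)).
apply: cvgN; rewrite -[X in _ --> X](mul0r `|u|); apply: cvgM; last exact: cvg_cst.
exact: cvg_harmonic.
Qed.

Variable H : R -> R.
Hypothesis iH : mu.-integrable setT (EFin \o H).
Hypothesis waveH : forall s u, `|wave_transform s u| <= H u.

Let h s := \int[mu]_u wave_transform s u.

Let mh : measurable_fun setT h.
Proof. exact: (measurable_Rintegral2 mu measurable_wave_transform). Qed.

Let mwave_transform s : measurable_fun setT (wave_transform s).
Proof. exact: (measurableT_comp measurable_wave_transform (pair1_measurable s)). Qed.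

Let Rintegral_bound (f : R -> R) : measurable_fun setT f ->
  (forall u, `|f u| <= H u) -> `|\int[mu]_u f u| <= \int[mu]_u H u.
Proof.
move=> mf fH; have intf : mu.-integrable setT (EFin \o f).
  apply: le_integrable iH => //; first by apply/measurable_EFinP.
  by move=> u _; rewrite lee_fin (le_trans (fH u))// ler_norm.
apply: (le_trans (le_normr_Rintegral measurableT intf)).
by apply: le_Rintegral => //; exact: integrable_norm.
Qed.

Let wave_abelH e s u : 0 < e -> `|wave_transform s u * abel e u| <= H u.
Proof.
move=> e0; rewrite normrM (le_trans _ (waveH s u))// ler_piMr//.
by rewrite ger0_norm ?abel_ge0// abel_le1.
Qed.

Let cvg_lhs (p q : R) :
  \int[mu]_s (\1_`[p, q]%classic s * \int[mu]_u (wave_transform s u * abel n.+1%:R^-1 u))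
    @[n --> \oo] --> \int[mu]_s (\1_`[p, q]%classic s * h s).
Proof.
have mpa (e : R) s : measurable_fun setT (fun u => wave_transform s u * abel e u).
  by apply: measurable_funM; [exact: mwave_transform|exact: measurable_abel].
apply: (@cvg_Rintegral _ _ _ mu _ _
  (fun s => \1_`[p, q]%classic s * \int[mu]_u H u)).
- move=> n; apply: measurable_funM; first exact: measurable_indic.
  have mpa2 : measurable_fun setT
      (fun z : R * R => wave_transform z.1 z.2 * abel n.+1%:R^-1 z.2).
    apply: measurable_funM; first exact: measurable_wave_transform.
    by apply: measurableT_comp; [exact: measurable_abel|].
  exact: (measurable_Rintegral2 mu mpa2).
- by apply: measurable_funM => //; exact: measurable_indic.
- apply: aeW => s; apply: cvgM; first exact: cvg_cst.
  apply: (@cvg_Rintegral _ _ _ mu _ _ H) => //.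
  + by move=> n; exact: mpa.
  + exact: mwave_transform.
  + by apply: aeW => u; rewrite -[X in _ --> X]mulr1;
      apply: cvgM; [exact: cvg_cst|exact: cvg_abel_harmonic].
  + by move=> n u; exact: wave_abelH.
- apply: (integrableM_bounded (C := `|\int[mu]_u H u|)) => //.
  exact: integrable_indic_itv.
- move=> n s; rewrite normrM ger0_norm// ler_wpM2l//.
  by apply: Rintegral_bound => // u; exact: wave_abelH.
Qed.

Let cvg_rhs (p q : R) : p < q ->
  \int[mu]_y (g1 y * (2 / b * (atan (b * (y - p) / n.+1%:R^-1) -
                               atan (b * (y - q) / n.+1%:R^-1))))
    @[n --> \oo] --> \int[mu]_y (g1 y * (2 * pi / b * \1_`[p, q]%classic y)).
Proof.
move=> pq; apply: (@cvg_Rintegral _ _ _ mu _ _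
  (fun y => `|g1 y| * (2 / b * pi))).
- by move=> n; mfun.
- by apply: measurable_funM => //; apply: measurable_funM => //; exact: measurable_indic.
- exists [set p; q]; split.
  + exact: measurableU.
  + rewrite measureU0//; exact: lebesgue_measure_set1.
  + move=> y /= ny; apply: contrapT => /not_orP[/eqP yp /eqP yq]; apply: ny.
    by apply: cvgM; [exact: cvg_cst|exact: cvg_atan_itv].
- apply: (integrableM_bounded (C := `|2 / b * pi|)) => //.
  exact: integrable_norm.
- move=> n y; rewrite normrM ler_wpM2l// normrM ger0_norm; last by rewrite divr_ge0// ltW.
  rewrite ler_wpM2l ?divr_ge0 ?(ltW b0)//.
  rewrite (le_trans (ler_normB _ _))// [leRHS](_ : _ = pi / 2 + pi / 2); last by field.
  by rewrite lerD// ler_norml !ltW ?atan_gtNpi2 ?atan_ltpi2.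
Qed.

(** Regularised inversion formulas are compared after integration over
    [[p, q]]: both sides pass to the limit by dominated convergence, the left
    one with dominating function [H], the right one because the arctangents
    are bounded. *)
Lemma fourier_inversion_cos_sin : {ae mu, forall s,
  2 * pi / b * g1 s = \int[mu]_u wave_transform s u}.
Proof.
pose k s := h s - 2 * pi / b * g1 s.
have ig1c : mu.-integrable setT (EFin \o (fun s => 2 * pi / b * g1 s)).
  exact: (integrableZl measurableT (2 * pi / b) ig1).
(* The inverse transform is bounded by the integral of [H]. *)
have lh : locally_integrable setT h.
  split => //; first exact: openT.
  move=> K _ cK; have mK := compact_measurable cK.
  apply: (@le_lt_trans _ _ (\int[mu]_(x in K) (cst (\int[mu]_u H u)%:E) x)%E).
    apply: ge0_le_integral => //.
    - by apply/measurable_EFinP; apply: measurable_funTS; apply: measurableT_comp.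
    - by move=> s _; rewrite lee_fin; apply: Rintegral_bound.
  rewrite (integral_cst mu mK (\int[mu]_u H u)%:E).
  apply: lte_mul_pinfty => //; last exact: compact_finite_measure.
  rewrite lee_fin; apply: le_trans (Rintegral_bound (mwave_transform 0) (waveH 0)).
  exact: normr_ge0.
have lk : locally_integrable setT k.
  apply: locally_integrableB => //; apply: open_integrable_locally => //.
  exact: openT.
suff : {ae mu, forall s, k s = 0} by apply: ae_imply => s /subr0_eq; rewrite /h.
apply: ae_eq0_of_itv_integral0 lk _ => p q pq.
have iI : mu.-integrable setT (EFin \o (\1_`[p, q]%classic : R -> R)).
  exact: integrable_indic_itv.
have ih : mu.-integrable setT (EFin \o (fun s => \1_`[p, q]%classic s * h s)).
  by apply: (integrableM_bounded (C := \int[mu]_u H u)) => // s; exact: Rintegral_bound.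
have ig : mu.-integrable setT
    (EFin \o (fun s => g1 s * (2 * pi / b * \1_`[p, q]%classic s))).
  apply: (integrableM_bounded (C := 2 * pi / b)) => //.
    by apply: measurable_funM => //; exact: measurable_indic.
  move=> s; rewrite normrM ger0_norm; last by rewrite divr_ge0 ?mulr_ge0 ?pi_ge0// ltW.
  rewrite ler_piMr ?divr_ge0 ?mulr_ge0 ?pi_ge0 ?(ltW b0)//.
  by rewrite indicE ger0_norm//; case: (_ \in _).
have ik : mu.-integrable setT (EFin \o (fun s => \1_`[p, q]%classic s * k s)).
  have := integrableB measurableT ih ig.
  apply: eq_integrable => // s _ /=; rewrite -EFinB; congr EFin.
  by rewrite /k; ring.
have E : \int[mu]_s (\1_`[p, q]%classic s * h s) =
         \int[mu]_y (g1 y * (2 * pi / b * \1_`[p, q]%classic y)).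
  have := @cvg_lhs p q; under eq_fun => n do rewrite integral_itv_wave_abel//.
  by move=> /(cvg_lim _) <- //; apply/cvg_lim => //; exact: cvg_rhs.
rewrite integral_mkcond.
transitivity (\int[mu]_s (\1_`[p, q]%classic s * k s)%:E)%E.
  apply: eq_integral => s _; rewrite patchE indicE.
  by case: ifP => _ /=; rewrite ?mul1r ?mul0r.
rewrite -[LHS]fineK; last exact: integrable_fin_num.
rewrite -/(Rintegral _ _ _); congr EFin.
transitivity (\int[mu]_s (\1_`[p, q]%classic s * h s -
   g1 s * (2 * pi / b * \1_`[p, q]%classic s))).
  by apply: eq_Rintegral => s _; rewrite /k; ring.
by rewrite RintegralB// E subrr.
Qed.

End AbelSummation.
End FourierInversion.

(** * Inversion of chirped Fourier transforms *)

Section ChirpInversion.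
Variable R : realType.
Local Notation mu := (@lebesgue_measure R).
Variables (a b c t0 k : R).
Hypotheses (b0 : 0 < b) (k0 : 0 < k) (kE : k ^+ 2 = b / (2 * pi)).

(** The phase of a linear canonical kernel; [t0] and, below, [k] carry the
    argument and the modulus of its normalising factor. *)
Definition chirp_phase x u : R := a * x ^+ 2 - b * x * u + c * u ^+ 2 + t0.
Definition chirp_cos x u : R := k * cos (chirp_phase x u).
Definition chirp_sin x u : R := k * sin (chirp_phase x u).

Lemma measurable_chirp_cos1 u : measurable_fun setT (chirp_cos ^~ u).
Proof. by rewrite /chirp_cos /chirp_phase; mfun. Qed.

Lemma measurable_chirp_sin1 u : measurable_fun setT (chirp_sin ^~ u).
Proof. by rewrite /chirp_sin /chirp_phase; mfun. Qed.

Lemma chirp_cos_le x u : `|chirp_cos x u| <= k.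
Proof. by rewrite normrM gtr0_norm// ler_piMr ?(ltW k0)// cos_max. Qed.

Lemma chirp_sin_le x u : `|chirp_sin x u| <= k.
Proof. by rewrite normrM gtr0_norm// ler_piMr ?(ltW k0)// sin_max. Qed.

Definition chirp_re (f1 f2 : R -> R) u :=
  \int[mu]_x (f1 x * chirp_cos x u - f2 x * chirp_sin x u).
Definition chirp_im (f1 f2 : R -> R) u :=
  \int[mu]_x (f1 x * chirp_sin x u + f2 x * chirp_cos x u).

Variables f1 f2 : R -> R.
Hypotheses (if1 : mu.-integrable setT (EFin \o f1))
           (if2 : mu.-integrable setT (EFin \o f2)).

Local Notation F1 := (chirp_re f1 f2).
Local Notation F2 := (chirp_im f1 f2).

Hypotheses (iF1 : mu.-integrable setT (EFin \o F1))
           (iF2 : mu.-integrable setT (EFin \o F2)).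

(** [g1 + i g2] is [f1 + i f2] multiplied by the time chirp [exp(i a x^2)]. *)
Let g1 x := f1 x * cos (a * x ^+ 2) - f2 x * sin (a * x ^+ 2).
Let g2 x := f1 x * sin (a * x ^+ 2) + f2 x * cos (a * x ^+ 2).

Let imul (f : R -> R) (h : R -> R) C : mu.-integrable setT (EFin \o f) ->
  measurable_fun setT h -> (forall x, `|h x| <= C) ->
  mu.-integrable setT (EFin \o (fun x => f x * h x)).
Proof. by move=> intf mh hC; apply: (integrableM_bounded (C := C) intf) => //. Qed.

Let ig1 : mu.-integrable setT (EFin \o g1).
Proof.
apply: (integrableB measurableT (imul (C := 1) if1 _ _) (imul (C := 1) if2 _ _)).
- by mfun.
- by move=> x; exact: cos_max.
- by mfun.
- by move=> x; exact: sin_max.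
Qed.

Let ig2 : mu.-integrable setT (EFin \o g2).
Proof.
apply: (integrableD measurableT (imul (C := 1) if1 _ _) (imul (C := 1) if2 _ _)).
- by mfun.
- by move=> x; exact: sin_max.
- by mfun.
- by move=> x; exact: cos_max.
Qed.

Let ig1N : mu.-integrable setT (EFin \o (fun x => - g1 x)).
Proof. exact: (integrableN ig1). Qed.

Let icos f u : mu.-integrable setT (EFin \o f) ->
  mu.-integrable setT (EFin \o (fun x => f x * chirp_cos x u)).
Proof.
move=> intf; apply: imul intf _ _; first exact: measurable_chirp_cos1.
by move=> x; exact: chirp_cos_le.
Qed.

Let isin f u : mu.-integrable setT (EFin \o f) ->
  mu.-integrable setT (EFin \o (fun x => f x * chirp_sin x u)).
Proof.
move=> intf; apply: imul intf _ _; first exact: measurable_chirp_sin1.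
by move=> x; exact: chirp_sin_le.
Qed.

(** The phase without its time chirp.  It is what the forward transform has to
    be rotated back by in order to become a plain wave transform. *)
Let phi s u := chirp_phase s u - a * s ^+ 2.

Let F12_lin u p q : F1 u * p + F2 u * q =
  \int[mu]_x ((f1 x * chirp_cos x u - f2 x * chirp_sin x u) * p +
              (f1 x * chirp_sin x u + f2 x * chirp_cos x u) * q).
Proof.
have i1 := integrableB measurableT (icos u if1) (isin u if2).
have i2 := integrableD measurableT (isin u if1) (icos u if2).
rewrite RintegralD//; last 2 first.
- exact: (integrableZr measurableT p i1).
- exact: (integrableZr measurableT q i2).
by rewrite !RintegralZr.
Qed.

Let iwave (h1 h2 : R -> R) s u : mu.-integrable setT (EFin \o h1) ->
  mu.-integrable setT (EFin \o h2) ->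
  mu.-integrable setT (EFin \o wave b h1 h2 s u).
Proof.
move=> i1 i2.
apply: (integrableD measurableT (imul (C := 1) i1 _ _) (imul (C := 1) i2 _ _)).
- by mfun.
- by move=> x; exact: cos_max.
- by mfun.
- by move=> x; exact: sin_max.
Qed.

Let phaseE s u y : chirp_phase y u = a * y ^+ 2 - b * (y - s) * u + phi s u.
Proof. by rewrite /phi /chirp_phase; ring. Qed.

(** The frequency chirp [c u^2] and the constant [t0] occur in both
    [chirp_phase y u] and [phi s u], and so disappear from the product of the
    kernel with its inverse. *)
Let wave1E s u : wave_transform b g1 g2 s u =
  k^-1 * (F1 u * cos (phi s u) + F2 u * sin (phi s u)).
Proof.
apply: (canRL (mulKf (lt0r_neq0 k0))); rewrite F12_lin -RintegralZl//; last exact: iwave.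
apply: eq_Rintegral => y _; rewrite /wave /g1 /g2 /chirp_cos /chirp_sin.
rewrite (phaseE s u y); move: (phi s u) => P; rewrite (cosD _ P) (sinD _ P) cosB sinB.
by rewrite -[LHS]mulr1 -(cos2Dsin2 P); ring.
Qed.

(** Same as [wave1E] for the product of the chirped function with [- i], which
    exchanges real and imaginary parts. *)
Let wave2E s u : wave_transform b g2 (fun x => - g1 x) s u =
  k^-1 * (F1 u * - sin (phi s u) + F2 u * cos (phi s u)).
Proof.
apply: (canRL (mulKf (lt0r_neq0 k0))); rewrite F12_lin -RintegralZl//; last exact: iwave.
apply: eq_Rintegral => y _; rewrite /wave /g1 /g2 /chirp_cos /chirp_sin.
rewrite (phaseE s u y); move: (phi s u) => P; rewrite (cosD _ P) (sinD _ P) cosB sinB.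
by rewrite -[LHS]mulr1 -(cos2Dsin2 P); ring.
Qed.

Let H u := k^-1 * (`|F1 u| + `|F2 u|).

Let iH : mu.-integrable setT (EFin \o H).
Proof.
have := integrableD measurableT (integrable_norm iF1) (integrable_norm iF2).
exact: (integrableZl measurableT k^-1).
Qed.

Let waveH p q u : `|p| <= 1 -> `|q| <= 1 -> `|k^-1 * (F1 u * p + F2 u * q)| <= H u.
Proof.
move=> p1 q1; rewrite normrM gtr0_norm ?invr_gt0// ler_pM2l ?invr_gt0//.
by rewrite (le_trans (ler_normD _ _))// lerD// normrM ler_piMr.
Qed.

Let wave1H s u : `|wave_transform b g1 g2 s u| <= H u.
Proof. by rewrite wave1E waveH ?cos_max ?sin_max. Qed.

Let wave2H s u : `|wave_transform b g2 (fun x => - g1 x) s u| <= H u.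
Proof. by rewrite wave2E waveH ?normrN ?cos_max ?sin_max. Qed.

(** Fourier inversion recovers both components of the chirped function, and
    rotating back by [a s^2] recovers [f1].  The condition on [k] is the
    normalisation [k * k * (2 pi / b) = 1]. *)
Lemma chirp_inversion : {ae mu, forall s,
  f1 s = \int[mu]_u (F1 u * chirp_cos s u + F2 u * chirp_sin s u)}.
Proof.
have H1 := fourier_inversion_cos_sin b0 ig1 ig2 iH wave1H.
have H2 := fourier_inversion_cos_sin b0 ig2 ig1N iH wave2H.
apply: ae_imply2 H1 H2 => s g1s g2s.
have iw (h1 h2 : R -> R) : measurable_fun setT h1 -> measurable_fun setT h2 ->
    (forall u, `|wave_transform b h1 h2 s u| <= H u) ->
    mu.-integrable setT (EFin \o wave_transform b h1 h2 s).
  move=> mh1 mh2 hH; apply: le_integrable iH => //.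
    apply/measurable_EFinP.
    exact: (measurableT_comp (measurable_wave_transform b mh1 mh2) (pair1_measurable s)).
  by move=> u _; rewrite lee_fin (le_trans (hH u))// ler_norm.
have mg1 : measurable_fun setT g1.
  by apply/measurable_EFinP; exact: (measurable_int mu ig1).
have mg2 : measurable_fun setT g2.
  by apply/measurable_EFinP; exact: (measurable_int mu ig2).
have iw1 : mu.-integrable setT (EFin \o wave_transform b g1 g2 s).
  exact: iw.
have iw2 : mu.-integrable setT (EFin \o wave_transform b g2 (fun x => - g1 x) s).
  by apply: iw => //; mfun.
have -> : f1 s = k ^+ 2 * (2 * pi / b * g1 s * cos (a * s ^+ 2) +
                           2 * pi / b * g2 s * sin (a * s ^+ 2)).
  rewrite kE /g1 /g2 -[LHS]mulr1.
  rewrite -[X in _ * X = _](cos2Dsin2 (a * s ^+ 2)).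
  have pi0 : pi != 0 :> R by rewrite gt_eqF ?pi_gt0.
  by move: (pi : R) pi0 => p p0; field; rewrite p0 gt_eqF.
rewrite g1s g2s -!RintegralZr// -RintegralD//; last 2 first.
- exact: (integrableZr measurableT _ iw1).
- exact: (integrableZr measurableT _ iw2).
rewrite -RintegralZl//; last first.
  exact: (integrableD measurableT (integrableZr measurableT _ iw1)
    (integrableZr measurableT _ iw2)).
apply: eq_Rintegral => u _; rewrite wave1E wave2E /chirp_cos /chirp_sin.
have -> : chirp_phase s u = phi s u + a * s ^+ 2 by rewrite /phi subrK.
by move: (phi s u) => P; rewrite cosD sinD; field; rewrite gt_eqF.
Qed.

End ChirpInversion.

Section ChirpInversionPair.
Variable R : realType.
Local Notation mu := (@lebesgue_measure R).
Variables (a b c t0 k : R) (f1 f2 : R -> R).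
Hypotheses (b0 : 0 < b) (k0 : 0 < k) (kE : k ^+ 2 = b / (2 * pi)).
Hypotheses (if1 : mu.-integrable setT (EFin \o f1))
           (if2 : mu.-integrable setT (EFin \o f2)).
Local Notation F1 := (chirp_re a b c t0 k f1 f2).
Local Notation F2 := (chirp_im a b c t0 k f1 f2).
Local Notation ccos := (chirp_cos a b c t0 k).
Local Notation csin := (chirp_sin a b c t0 k).
Hypotheses (iF1 : mu.-integrable setT (EFin \o F1))
           (iF2 : mu.-integrable setT (EFin \o F2)).

(** The imaginary part of [f1 + i f2] is the real part of [f2 - i f1]. *)
Lemma chirp_inversion_im : {ae mu, forall s,
  f2 s = \int[mu]_u (F2 u * ccos s u - F1 u * csin s u)}.
Proof.
have re2 : chirp_re a b c t0 k f2 (fun x => - f1 x) = F2.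
  by apply/funext => u; apply: eq_Rintegral => x _; ring.
have im2 : chirp_im a b c t0 k f2 (fun x => - f1 x) = fun u => - F1 u.
  apply/funext => u; rewrite -mulN1r -RintegralZl//.
    by apply: eq_Rintegral => x _; ring.
  have i1 : mu.-integrable setT (EFin \o (fun x => f1 x * ccos x u)).
    apply: (integrableM_bounded (C := k) if1) => [|x]; last exact: chirp_cos_le.
    exact: measurable_chirp_cos1.
  have i2 : mu.-integrable setT (EFin \o (fun x => f2 x * csin x u)).
    apply: (integrableM_bounded (C := k) if2) => [|x]; last exact: chirp_sin_le.
    exact: measurable_chirp_sin1.
  exact: (integrableB measurableT i1 i2).
have iF1N : mu.-integrable setT (EFin \o (fun u => - F1 u)).
  exact: (integrableN iF1).
have if1N : mu.-integrable setT (EFin \o (fun x => - f1 x)).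
  exact: (integrableN if1).
have := @chirp_inversion _ a b c t0 k b0 k0 kE f2 (fun x => - f1 x) if2 if1N.
rewrite re2 im2 => /(_ iF2 iF1N); apply: ae_imply => s ->.
by apply: eq_Rintegral => u _; ring.
Qed.

End ChirpInversionPair.

(** * Integrals of quaternion-valued functions *)

Section QuaternionIntegral.
Context d (T : measurableType d) (R : realType).
Variable m : {measure set T -> \bar R}.
Implicit Types (f g K : T -> quaternion R) (c : quaternion R).

Definition measurableq f : Prop :=
  [/\ measurable_fun setT (fun x => qre (f x)), measurable_fun setT (fun x => qi (f x)),
      measurable_fun setT (fun x => qj (f x)) & measurable_fun setT (fun x => qk (f x))].

Definition integrableq f : Prop :=
  [/\ m.-integrable setT (EFin \o (fun x => qre (f x))),
      m.-integrable setT (EFin \o (fun x => qi (f x))),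
      m.-integrable setT (EFin \o (fun x => qj (f x))) &
      m.-integrable setT (EFin \o (fun x => qk (f x)))].

Definition intq f : quaternion R :=
  Quat (\int[m]_x qre (f x)) (\int[m]_x qi (f x))
       (\int[m]_x qj (f x)) (\int[m]_x qk (f x)).

Lemma quat_eq (p q : quaternion R) :
  qre p = qre q -> qi p = qi q -> qj p = qj q -> qk p = qk q -> p = q.
Proof. by case: p => a b e h; case: q => a' b' e' h' /= -> -> -> ->. Qed.

Lemma le_normq (q : quaternion R) : [/\ `|qre q| <= normq q, `|qi q| <= normq q,
  `|qj q| <= normq q & `|qk q| <= normq q].
Proof.
have H (x y : R) : x ^+ 2 <= y -> `|x| <= Num.sqrt y.
  by move=> xy; rewrite -sqrtr_sqr ler_wsqrtr.
have p (x : R) := sqr_ge0 x.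
have [] := (p (qre q), p (qi q), p (qj q), p (qk q)) => -[[p1 p2] p3] p4.
by split; apply: H; lra.
Qed.

Lemma integrableq_measurable f : integrableq f -> measurableq f.
Proof.
by case=> h1 h2 h3 h4; split; apply/measurable_EFinP; exact: (measurable_int m).
Qed.

Lemma measurableq_mul f g : measurableq f -> measurableq g ->
  measurableq (fun x => f x * g x)%quat.
Proof. by move=> [? ? ? ?] [? ? ? ?]; split; rewrite /mulq/=; mfun. Qed.

Lemma integrableq_mulr f K C : integrableq f -> measurableq K ->
  (forall x, normq (K x) <= C) -> integrableq (fun x => f x * K x)%quat.
Proof.
move=> [f1 f2 f3 f4] [K1 K2 K3 K4] KC.
have H (h : T -> R) : m.-integrable setT (EFin \o h) ->
    [/\ m.-integrable setT (EFin \o (fun x => h x * qre (K x))),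
        m.-integrable setT (EFin \o (fun x => h x * qi (K x))),
        m.-integrable setT (EFin \o (fun x => h x * qj (K x))) &
        m.-integrable setT (EFin \o (fun x => h x * qk (K x)))].
  by move=> ih; split; apply: (integrableM_bounded (C := C) ih) => // x;
    apply: le_trans (KC x); case: (le_normq (K x)).
have [a1 a2 a3 a4] := H _ f1; have [b1 b2 b3 b4] := H _ f2.
have [c1 c2 c3 c4] := H _ f3; have [e1 e2 e3 e4] := H _ f4.
pose D := @integrableD _ _ _ m _ measurableT; pose B := @integrableB _ _ _ m _ measurableT.
split.
- exact: (B _ _ (B _ _ (B _ _ a1 b2) c3) e4).
- exact: (B _ _ (D _ _ (D _ _ a2 b1) c4) e3).
- exact: (D _ _ (D _ _ (B _ _ a3 b4) c1) e2).
- exact: (D _ _ (B _ _ (D _ _ a4 b3) c2) e1).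
Qed.

Lemma intq_mulr f c : integrableq f ->
  intq (fun x => f x * c)%quat = (intq f * c)%quat.
Proof.
move=> [f1 f2 f3 f4].
have iZ (h : T -> R) r : m.-integrable setT (EFin \o h) ->
    m.-integrable setT (EFin \o (fun x => h x * r)).
  by move=> ih; exact: (integrableZr measurableT r ih).
have iD (h k : T -> R) : m.-integrable setT (EFin \o h) ->
    m.-integrable setT (EFin \o k) -> m.-integrable setT (EFin \o (fun x => h x + k x)).
  by move=> ih ik; exact: (integrableD measurableT ih ik).
have iB (h k : T -> R) : m.-integrable setT (EFin \o h) ->
    m.-integrable setT (EFin \o k) -> m.-integrable setT (EFin \o (fun x => h x - k x)).
  by move=> ih ik; exact: (integrableB measurableT ih ik).
have [a1 a2 a3 a4] := And4 (iZ _ (qre c) f1) (iZ _ (qi c) f1) (iZ _ (qj c) f1) (iZ _ (qk c) f1).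
have [b1 b2 b3 b4] := And4 (iZ _ (qre c) f2) (iZ _ (qi c) f2) (iZ _ (qj c) f2) (iZ _ (qk c) f2).
have [c1 c2 c3 c4] := And4 (iZ _ (qre c) f3) (iZ _ (qi c) f3) (iZ _ (qj c) f3) (iZ _ (qk c) f3).
have [e1 e2 e3 e4] := And4 (iZ _ (qre c) f4) (iZ _ (qi c) f4) (iZ _ (qj c) f4) (iZ _ (qk c) f4).
apply: quat_eq => /=.
- rewrite (RintegralB measurableT (iB _ _ (iB _ _ a1 b2) c3) e4).
  by rewrite (RintegralB measurableT (iB _ _ a1 b2) c3) (RintegralB measurableT a1 b2) !RintegralZr.
- rewrite (RintegralB measurableT (iD _ _ (iD _ _ a2 b1) c4) e3).
  by rewrite (RintegralD measurableT (iD _ _ a2 b1) c4) (RintegralD measurableT a2 b1) !RintegralZr.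
- rewrite (RintegralD measurableT (iD _ _ (iB _ _ a3 b4) c1) e2).
  by rewrite (RintegralD measurableT (iB _ _ a3 b4) c1) (RintegralB measurableT a3 b4) !RintegralZr.
- rewrite (RintegralD measurableT (iB _ _ (iD _ _ a4 b3) c2) e1).
  by rewrite (RintegralB measurableT (iD _ _ a4 b3) c2) (RintegralD measurableT a4 b3) !RintegralZr.
Qed.

Lemma ae_intq f g : {ae m, forall x, f x = g x} -> intq f = intq g.
Proof. by move=> fg; apply: quat_eq; apply: ae_Rintegral; apply: ae_imply fg => x ->. Qed.

Lemma ae_integrableq f g : {ae m, forall x, f x = g x} ->
  integrableq f -> measurableq g -> integrableq g.
Proof.
move=> fg [f1 f2 f3 f4] [g1 g2 g3 g4].
have H (co : quaternion R -> R) : measurable_fun setT (fun x => co (g x)) ->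
    m.-integrable setT (EFin \o (fun x => co (f x))) ->
    m.-integrable setT (EFin \o (fun x => co (g x))).
  move=> mg /integrableP[mf fi]; apply/integrableP; split; first exact/measurable_EFinP.
  apply: le_lt_trans fi; rewrite le_eqVlt; apply/orP; left; apply/eqP.
  apply: ae_eq_integral => //.
  - by apply: measurableT_comp => //; exact/measurable_EFinP.
  - exact: measurableT_comp.
  - by apply: ae_imply fg => x fx _ /=; rewrite fx.
by split; apply: H.
Qed.

Lemma measurable_eqq f g : measurableq f -> measurableq g ->
  measurable [set x | f x = g x].
Proof.
move=> [f1 f2 f3 f4] [g1 g2 g3 g4].
have H (h k : T -> R) : measurable_fun setT h -> measurable_fun setT k ->
    measurable [set x | h x = k x].
  move=> mh mk; have mhk : measurable_fun setT (fun x => h x - k x) by mfun.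
  have := mhk measurableT [set 0] (measurable_set1 0); rewrite setTI.
  congr measurable; apply/seteqP; split => x /=; first exact: subr0_eq.
  by move=> ->; rewrite subrr.
have -> : [set x | f x = g x] =
    [set x | qre (f x) = qre (g x)] `&` [set x | qi (f x) = qi (g x)] `&`
    [set x | qj (f x) = qj (g x)] `&` [set x | qk (f x) = qk (g x)].
  apply/seteqP; split => x /=; first by move=> ->.
  by move=> [[[]]]; exact: quat_eq.
by do 3 (apply: measurableI; last exact: H); exact: H.
Qed.

End QuaternionIntegral.

Lemma measurableq_comp d1 d2 (T1 : measurableType d1) (T2 : measurableType d2)
    (R : realType) (f : T2 -> quaternion R) (g : T1 -> T2) :
  measurableq f -> measurable_fun setT g -> measurableq (fun x => f (g x)).
Proof. by move=> [f1 f2 f3 f4] mg; split;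
  [exact: (measurableT_comp f1 mg)|exact: (measurableT_comp f2 mg)|
   exact: (measurableT_comp f3 mg)|exact: (measurableT_comp f4 mg)].
Qed.

Section QuaternionFubini.
Context d1 d2 (T1 : measurableType d1) (T2 : measurableType d2) (R : realType).
Variable m1 : {sigma_finite_measure set T1 -> \bar R}.
Variable m2 : {sigma_finite_measure set T2 -> \bar R}.
Implicit Types h : T1 * T2 -> quaternion R.

Lemma measurableq_intq2 h : measurableq h ->
  measurableq (fun x => intq m2 (fun y => h (x, y))).
Proof.
move=> [h1 h2 h3 h4]; split.
- exact: (measurable_Rintegral2 m2 h1).
- exact: (measurable_Rintegral2 m2 h2).
- exact: (measurable_Rintegral2 m2 h3).
- exact: (measurable_Rintegral2 m2 h4).
Qed.

Lemma intq_prod12 h : integrableq (m1 \x m2)%E h ->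
  intq (m1 \x m2)%E h = intq m1 (fun x => intq m2 (fun y => h (x, y))).
Proof.
by move=> [h1 h2 h3 h4]; apply: quat_eq => /=;
  [rewrite (Rintegral_prod12 h1)|rewrite (Rintegral_prod12 h2)
  |rewrite (Rintegral_prod12 h3)|rewrite (Rintegral_prod12 h4)].
Qed.

Lemma intq_prod21 h : integrableq (m1 \x m2)%E h ->
  intq (m1 \x m2)%E h = intq m2 (fun y => intq m1 (fun x => h (x, y))).
Proof.
by move=> [h1 h2 h3 h4]; apply: quat_eq => /=;
  [rewrite (Rintegral_prod21 h1)|rewrite (Rintegral_prod21 h2)
  |rewrite (Rintegral_prod21 h3)|rewrite (Rintegral_prod21 h4)].
Qed.

Lemma integrableq_intq2 h : integrableq (m1 \x m2)%E h ->
  integrableq m1 (fun x => intq m2 (fun y => h (x, y))).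
Proof.
move=> [h1 h2 h3 h4]; split.
- exact: (integrable_Rintegral2 h1).
- exact: (integrable_Rintegral2 h2).
- exact: (integrable_Rintegral2 h3).
- exact: (integrable_Rintegral2 h4).
Qed.

Lemma integrableq_intq1 h : integrableq (m1 \x m2)%E h ->
  integrableq m2 (fun y => intq m1 (fun x => h (x, y))).
Proof.
move=> [h1 h2 h3 h4]; split.
- exact: (integrable_Rintegral1 h1).
- exact: (integrable_Rintegral1 h2).
- exact: (integrable_Rintegral1 h3).
- exact: (integrable_Rintegral1 h4).
Qed.

Lemma ae_integrableq2 h : integrableq (m1 \x m2)%E h ->
  {ae m1, forall x, integrableq m2 (fun y => h (x, y))}.
Proof.
move=> [/ae_integrable1 h1 /ae_integrable1 h2 /ae_integrable1 h3 /ae_integrable1 h4].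
by apply: filterS2 (filterI h1 h2) (filterI h3 h4) => x [? ?] [? ?].
Qed.

Lemma ae_integrableq1 h : integrableq (m1 \x m2)%E h ->
  {ae m2, forall y, integrableq m1 (fun x => h (x, y))}.
Proof.
move=> [/ae_integrable2 h1 /ae_integrable2 h2 /ae_integrable2 h3 /ae_integrable2 h4].
by apply: filterS2 (filterI h1 h2) (filterI h3 h4) => x [? ?] [? ?].
Qed.

End QuaternionFubini.

(** * Inverting one variable at a time *)

Section InversionPair.
Context dT dU (T : measurableType dT) (U : measurableType dU) (R : realType).
Variables (m : {measure set T -> \bar R}) (n : {measure set U -> \bar R}).

(** One-variable inversion for a pair of kernels acting by right
    multiplication.  The one-variable integrals occur literally, so that the
    property can be applied to sections. *)
Definition inversion_pair (K : T -> U -> quaternion R) (K' : U -> T -> quaternion R) :=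
  forall g : T -> quaternion R, integrableq m g ->
    integrableq n (fun u => intq m (fun x => g x * K x u)%quat) ->
  {ae m, forall s, g s =
    intq n (fun u => intq m (fun x => g x * K x u) * K' u s)%quat}.

Definition bounded_kernel (K : T -> U -> quaternion R) :=
  measurableq (fun z : T * U => K z.1 z.2) /\ exists C, forall x u, normq (K x u) <= C.

End InversionPair.

Section IteratedInversion.
Context dS dT dU dV (S : measurableType dS) (T : measurableType dT)
  (U : measurableType dU) (V : measurableType dV) (R : realType).
Variables (mS : {sigma_finite_measure set S -> \bar R})
  (mT : {sigma_finite_measure set T -> \bar R})
  (mU : {sigma_finite_measure set U -> \bar R})
  (mV : {sigma_finite_measure set V -> \bar R}).
Variables (K1 : S -> U -> quaternion R) (K1' : U -> S -> quaternion R)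
  (K2 : T -> V -> quaternion R) (K2' : V -> T -> quaternion R).
Hypotheses (bK1 : bounded_kernel K1) (bK1' : bounded_kernel K1')
  (bK2 : bounded_kernel K2) (bK2' : bounded_kernel K2').
Hypotheses (inv1 : inversion_pair mS mU K1 K1') (inv2 : inversion_pair mT mV K2 K2').

Definition transform2 (f : S * T -> quaternion R) (w : U * V) : quaternion R :=
  intq (mS \x mT)%E (fun p => f p * K1 p.1 w.1 * K2 p.2 w.2)%quat.

Definition inverse_transform2 (F : U * V -> quaternion R) (p : S * T) : quaternion R :=
  intq (mU \x mV)%E (fun w => F w * K2' w.2 p.2 * K1' w.1 p.1)%quat.

(** The iterated form of the integral is used because measurability in
    parameters is obtained one integration variable at a time. *)
Lemma measurable_transform2 f : integrableq (mS \x mT)%E f ->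
  measurableq (transform2 f).
Proof.
move=> intf; have mf := integrableq_measurable intf.
have [mK1 [C1 K1C]] := bK1; have [mK2 [C2 K2C]] := bK2.
have -> : transform2 f = fun w => intq mT (fun t => intq mS (fun s =>
    f (s, t) * K1 s w.1 * K2 t w.2)%quat).
  apply/funext => w; rewrite /transform2 intq_prod21//.
  apply: (integrableq_mulr (C := C2)) => //=; last first.
    exact: (measurableq_comp (measurableq_comp mK2 (pair2_measurable w.2)) measurable_snd).
  apply: (integrableq_mulr (C := C1) intf) => //=.
  exact: (measurableq_comp (measurableq_comp mK1 (pair2_measurable w.1)) measurable_fst).
have H : measurableq (fun z : ((U * V) * T) * S =>
    f (z.2, z.1.2) * K1 z.2 z.1.1.1 * K2 z.1.2 z.1.1.2)%quat.
  apply: measurableq_mul; first apply: measurableq_mul.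
  - apply: (measurableq_comp mf (g := fun z : ((U * V) * T) * S => (z.2, z.1.2))).
    by apply: measurable_fun_pair => //; do ?apply: measurableT_comp.
  - apply: (measurableq_comp mK1 (g := fun z : ((U * V) * T) * S => (z.2, z.1.1.1))).
    by apply: measurable_fun_pair => //; do ?apply: measurableT_comp.
  - apply: (measurableq_comp mK2 (g := fun z : ((U * V) * T) * S => (z.1.2, z.1.1.2))).
    by apply: measurable_fun_pair => //; do ?apply: measurableT_comp.
exact: (measurableq_intq2 mT (measurableq_intq2 mS H)).
Qed.

Lemma measurable_inverse_transform2 F : integrableq (mU \x mV)%E F ->
  measurableq (inverse_transform2 F).
Proof.
move=> iF; have mF := integrableq_measurable iF.
have [mK1' [C1' K1'C]] := bK1'; have [mK2' [C2' K2'C]] := bK2'.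
have -> : inverse_transform2 F = fun p => intq mV (fun v => intq mU (fun u =>
    F (u, v) * K2' v p.2 * K1' u p.1)%quat).
  apply/funext => p; rewrite /inverse_transform2 intq_prod21//.
  apply: (integrableq_mulr (C := C1')) => //=; last first.
    exact: (measurableq_comp (measurableq_comp mK1' (pair2_measurable p.1)) measurable_fst).
  apply: (integrableq_mulr (C := C2') iF) => //=.
  exact: (measurableq_comp (measurableq_comp mK2' (pair2_measurable p.2)) measurable_snd).
have H : measurableq (fun z : ((S * T) * V) * U =>
    F (z.2, z.1.2) * K2' z.1.2 z.1.1.2 * K1' z.2 z.1.1.1)%quat.
  apply: measurableq_mul; first apply: measurableq_mul.
  - apply: (measurableq_comp mF (g := fun z : ((S * T) * V) * U => (z.2, z.1.2))).
    by apply: measurable_fun_pair => //; do ?apply: measurableT_comp.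
  - apply: (measurableq_comp mK2' (g := fun z : ((S * T) * V) * U => (z.1.2, z.1.1.2))).
    by apply: measurable_fun_pair => //; do ?apply: measurableT_comp.
  - apply: (measurableq_comp mK1' (g := fun z : ((S * T) * V) * U => (z.2, z.1.1.1))).
    by apply: measurable_fun_pair => //; do ?apply: measurableT_comp.
exact: (measurableq_intq2 mV (measurableq_intq2 mU H)).
Qed.

(** The two almost-everywhere statements obtained from the one-variable
    inversions have their quantifiers in opposite orders; Fubini exchanges
    them, provided the exceptional sets are measurable, whence the joint
    measurability facts about [T1] and [W]. *)
Lemma iterated_inversion f : integrableq (mS \x mT)%E f ->
    (forall t, integrableq mS (fun s => f (s, t))) ->
    integrableq (mU \x mV)%E (transform2 f) ->
  {ae (mS \x mT)%E, forall p, f p = inverse_transform2 (transform2 f) p}.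
Proof.
move=> intf f_sec iF; have mf := integrableq_measurable intf.
set F := transform2 f in iF *; have mF := integrableq_measurable iF.
have [mK1 [C1 K1C]] := bK1; have [mK1' [C1' K1'C]] := bK1'.
have [mK2 [C2 K2C]] := bK2; have [mK2' [C2' K2'C]] := bK2'.
pose T1 t u := intq mS (fun s => f (s, t) * K1 s u)%quat.
pose W t u := intq mV (fun v => F (u, v) * K2' v t)%quat.
have mK1u u : measurableq (fun s => K1 s u).
  exact: (measurableq_comp mK1 (pair2_measurable u)).
have ifK1 u : integrableq (mS \x mT)%E (fun p => f p * K1 p.1 u)%quat.
  apply: (integrableq_mulr (C := C1) intf) => //.
  exact: (measurableq_comp (mK1u u) measurable_fst).
have iT1 u : integrableq mT (fun t => T1 t u).
  exact: (integrableq_intq1 (ifK1 u)).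
have FE u v : F (u, v) = intq mT (fun t => T1 t u * K2 t v)%quat.
  rewrite /F /transform2 intq_prod21; last first.
    apply: (integrableq_mulr (C := C2) (ifK1 u)) => //=.
    exact: (measurableq_comp (measurableq_comp mK2 (pair2_measurable v)) measurable_snd).
  congr intq; apply/funext => t; rewrite /= intq_mulr//.
  exact: (integrableq_mulr (C := C1) (f_sec t)).
have mT1 : measurableq (fun z : T * U => T1 z.1 z.2).
  suff H : measurableq (fun z : (T * U) * S => f (z.2, z.1.1) * K1 z.2 z.1.2)%quat.
    exact: (measurableq_intq2 mS H).
  apply: measurableq_mul.
  - apply: (measurableq_comp mf (g := fun z : (T * U) * S => (z.2, z.1.1))).
    by apply: measurable_fun_pair => //; apply: measurableT_comp.
  - apply: (measurableq_comp mK1 (g := fun z : (T * U) * S => (z.2, z.1.2))).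
    by apply: measurable_fun_pair => //; apply: measurableT_comp.
have mW : measurableq (fun z : T * U => W z.1 z.2).
  suff H : measurableq (fun z : (T * U) * V => F (z.1.2, z.2) * K2' z.2 z.1.1)%quat.
    exact: (measurableq_intq2 mV H).
  apply: measurableq_mul.
  - apply: (measurableq_comp mF (g := fun z : (T * U) * V => (z.1.2, z.2))).
    by apply: measurable_fun_pair => //; apply: measurableT_comp.
  - apply: (measurableq_comp mK2' (g := fun z : (T * U) * V => (z.2, z.1.1))).
    by apply: measurable_fun_pair => //; apply: measurableT_comp.
have aeUT : {ae mU, forall u, {ae mT, forall t, T1 t u = W t u}}.
  apply: ae_imply (ae_integrableq2 iF) => u iFu.
  have := inv2 (iT1 u); under [X in integrableq _ X]eq_fun do rewrite -FE.
  move=> /(_ iFu); apply: ae_imply => t ->; congr intq.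
  by apply/funext => v; rewrite FE.
(* Exchange of quantifiers: the exceptional set is Borel, hence null. *)
have aeTU : {ae mT, forall t, {ae mU, forall u, T1 t u = W t u}}.
  have mD := measurable_eqq mT1 mW.
  by apply: (@prod_ae12 _ _ _ _ _ mT mU _ mD); exact: (@ae_prod21 _ _ _ _ _ mT mU _ mD).
have iFK2 t : integrableq (mU \x mV)%E (fun w => F w * K2' w.2 t)%quat.
  apply: (integrableq_mulr (C := C2') iF) => //.
  exact: (measurableq_comp (measurableq_comp mK2' (pair2_measurable t)) measurable_snd).
have iW t : integrableq mU (W t) by exact: (integrableq_intq2 (iFK2 t)).
have invE s t : inverse_transform2 F (s, t) = intq mU (fun u => W t u * K1' u s)%quat.
  rewrite /inverse_transform2 intq_prod12; last first.
    apply: (integrableq_mulr (C := C1') (iFK2 t)) => //=.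
    exact: (measurableq_comp (measurableq_comp mK1' (pair2_measurable s)) measurable_fst).
  apply: ae_intq; apply: ae_imply (ae_integrableq2 (iFK2 t)) => u iFu.
  by rewrite /= intq_mulr.
apply: (@ae_prod21 _ _ _ _ _ mS mT).
  by apply: measurable_eqq => //; exact: measurable_inverse_transform2.
apply: ae_imply aeTU => t aeU.
(* [T1 t] inherits integrability from [W t], an integral of the transform. *)
have iT1t : integrableq mU (T1 t).
  apply: (ae_integrableq (f := W t)) (iW t) _; last first.
    exact: (measurableq_comp mT1 (pair1_measurable t)).
  by apply: ae_imply aeU => u ->.
apply: ae_imply (inv1 (f_sec t) iT1t) => s ->.
by rewrite invE; apply: ae_intq; apply: ae_imply aeU => u; rewrite /T1 => ->.
Qed.

End IteratedInversion.

(** * The one-variable linear canonical transforms *)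

Section LCTKernel.
Variable R : realType.
Local Notation mu := (@lebesgue_measure R).
Implicit Types (nu : quaternion R) (A : 'M[R]_2).

Lemma normq_le (q : quaternion R) C : `|qre q| <= C -> `|qi q| <= C ->
  `|qj q| <= C -> `|qk q| <= C -> normq q <= 2 * C.
Proof.
move=> h1 h2 h3 h4; have C0 : 0 <= C by apply: le_trans h1.
have H (x : R) : `|x| <= C -> x ^+ 2 <= C ^+ 2.
  by move=> xC; rewrite -real_normK ?num_real// lerXn2r// nnegrE.
have -> : 2 * C = Num.sqrt ((2 * C) ^+ 2).
  by rewrite sqrtr_sqr ger0_norm// mulr_ge0.
rewrite ler_wsqrtr//.
have [] := (H _ h1, H _ h2, H _ h3, H _ h4) => -[[p1 p2] p3] p4.
have -> : (2 * C) ^+ 2 = C ^+ 2 + C ^+ 2 + C ^+ 2 + C ^+ 2 by ring.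
by lra.
Qed.

Lemma normq_conjq (q : quaternion R) : normq (conjq q) = normq q.
Proof. by rewrite /normq /conjq /= !sqrrN. Qed.

(** The kernel [exp(nu * chirp_phase x u)] multiplied by [k]. *)
Definition chirpq nu (a b c t0 k x u : R) : quaternion R :=
  addq (Quat (chirp_cos a b c t0 k x u) 0 0 0)
       (scaleq (chirp_sin a b c t0 k x u) nu).

Lemma bounded_kernel_chirpq nu a b c t0 k : 0 < k ->
  bounded_kernel (chirpq nu a b c t0 k).
Proof.
move=> k0; split.
  by split; rewrite /chirpq /chirp_cos /chirp_sin /chirp_phase /=; mfun.
exists (2 * (k + k * normq nu)) => x u.
have [n1 n2 n3 n4] := le_normq nu.
have cle : `|chirp_cos a b c t0 k x u| <= k by exact: chirp_cos_le.
have sle y : `|y| <= normq nu -> `|chirp_sin a b c t0 k x u * y| <= k * normq nu.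
  by move=> yn; rewrite normrM ler_pM// chirp_sin_le.
have H y : `|y| <= k -> forall z, `|z| <= normq nu ->
    `|y + chirp_sin a b c t0 k x u * z| <= k + k * normq nu.
  by move=> yk z zn; rewrite (le_trans (ler_normD _ _))// lerD// sle.
by apply: normq_le; apply: H => //=; rewrite normr0 ltW.
Qed.

Lemma bounded_kernel_conjq (K : R -> R -> quaternion R) : bounded_kernel K ->
  bounded_kernel (fun u x => conjq (K x u)).
Proof.
move=> [mK [C KC]]; split; last by exists C => u x; rewrite normq_conjq.
have [m1 m2 m3 m4] := measurableq_comp mK (measurable_swap (T1 := R) (T2 := R)).
by split => /=; [exact: m1|exact: measurable_funN m2|exact: measurable_funN m3|
  exact: measurable_funN m4].
Qed.

Section Inversion.
Variables (a b c t0 k : R).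
Hypotheses (b0 : 0 < b) (k0 : 0 < k) (kE : k ^+ 2 = b / (2 * pi)).
Local Notation re := (chirp_re a b c t0 k).
Local Notation im := (chirp_im a b c t0 k).

(** Right multiplication by [exp(i theta)] maps (1, i) like a complex
    rotation, and also (k, j), since [k i = j] and [j i = - k]. *)
Lemma inversion_pair_chirpq_i :
  inversion_pair mu mu (chirpq quat_i a b c t0 k)
    (fun u x => conjq (chirpq quat_i a b c t0 k x u)).
Proof.
move=> g [g1 g2 g3 g4].
set G := fun u => intq mu (fun x => g x * chirpq quat_i a b c t0 k x u)%quat.
have E1 : (fun u => qre (G u)) = re (fun x => qre (g x)) (fun x => qi (g x)).
  by apply/funext => u; apply: eq_Rintegral => x _ /=; ring.
have E2 : (fun u => qi (G u)) = im (fun x => qre (g x)) (fun x => qi (g x)).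
  by apply/funext => u; apply: eq_Rintegral => x _ /=; ring.
have E3 : (fun u => qj (G u)) = im (fun x => qk (g x)) (fun x => qj (g x)).
  by apply/funext => u; apply: eq_Rintegral => x _ /=; ring.
have E4 : (fun u => qk (G u)) = re (fun x => qk (g x)) (fun x => qj (g x)).
  by apply/funext => u; apply: eq_Rintegral => x _ /=; ring.
move=> [i1 i2 i3 i4].
rewrite E1 in i1; rewrite E2 in i2; rewrite E3 in i3; rewrite E4 in i4.
have h1 := chirp_inversion b0 k0 kE g1 g2 i1 i2.
have h2 := chirp_inversion_im b0 k0 kE g1 g2 i1 i2.
have h3 := chirp_inversion b0 k0 kE g4 g3 i4 i3.
have h4 := chirp_inversion_im b0 k0 kE g4 g3 i4 i3.
have h12 := ae_imply2 (fun x => @conj _ _) h1 h2.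
have h34 := ae_imply2 (fun x => @conj _ _) h3 h4.
apply: ae_imply2 h12 h34 => s [s1 s2] [s3 s4].
by apply: quat_eq; rewrite ?s1 ?s2 ?s3 ?s4; apply: eq_Rintegral => u _;
  rewrite -/(G u) /mulq /conjq /chirpq; cbn [qre qi qj qk addq scaleq quat_i quat_j];
  rewrite -?E1 -?E2 -?E3 -?E4; cbv beta; move: (G u) => q; ring.
Qed.

(** Here the rotated pairs are (1, j) and (i, k), since [i j = k] and
    [k j = - i]. *)
Lemma inversion_pair_chirpq_j :
  inversion_pair mu mu (chirpq quat_j a b c t0 k)
    (fun u x => conjq (chirpq quat_j a b c t0 k x u)).
Proof.
move=> g [g1 g2 g3 g4].
set G := fun u => intq mu (fun x => g x * chirpq quat_j a b c t0 k x u)%quat.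
have E1 : (fun u => qre (G u)) = re (fun x => qre (g x)) (fun x => qj (g x)).
  by apply/funext => u; apply: eq_Rintegral => x _ /=; ring.
have E2 : (fun u => qj (G u)) = im (fun x => qre (g x)) (fun x => qj (g x)).
  by apply/funext => u; apply: eq_Rintegral => x _ /=; ring.
have E3 : (fun u => qi (G u)) = re (fun x => qi (g x)) (fun x => qk (g x)).
  by apply/funext => u; apply: eq_Rintegral => x _ /=; ring.
have E4 : (fun u => qk (G u)) = im (fun x => qi (g x)) (fun x => qk (g x)).
  by apply/funext => u; apply: eq_Rintegral => x _ /=; ring.
move=> [i1 i3 i2 i4].
rewrite E1 in i1; rewrite E2 in i2; rewrite E3 in i3; rewrite E4 in i4.
have h1 := chirp_inversion b0 k0 kE g1 g3 i1 i2.
have h2 := chirp_inversion_im b0 k0 kE g1 g3 i1 i2.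
have h3 := chirp_inversion b0 k0 kE g2 g4 i3 i4.
have h4 := chirp_inversion_im b0 k0 kE g2 g4 i3 i4.
have h12 := ae_imply2 (fun x => @conj _ _) h1 h2.
have h34 := ae_imply2 (fun x => @conj _ _) h3 h4.
apply: ae_imply2 h12 h34 => s [s1 s2] [s3 s4].
by apply: quat_eq; rewrite ?s1 ?s2 ?s3 ?s4; apply: eq_Rintegral => u _;
  rewrite -/(G u) /mulq /conjq /chirpq; cbn [qre qi qj qk addq scaleq quat_i quat_j];
  rewrite -?E1 -?E2 -?E3 -?E4; cbv beta; move: (G u) => q; ring.
Qed.

End Inversion.
End LCTKernel.

Section LCTKernelShape.
Variable R : realType.
Implicit Types (nu : quaternion R) (A : 'M[R]_2).

Definition imaginary_unit nu := qre nu = 0 /\ qi nu ^+ 2 + qj nu ^+ 2 + qk nu ^+ 2 = 1.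

Lemma imaginary_unit_i : imaginary_unit (quat_i : quaternion R).
Proof. by split => //=; ring. Qed.

Lemma imaginary_unit_j : imaginary_unit (quat_j : quaternion R).
Proof. by split => //=; ring. Qed.

(** All occurring exponentials have the same axis [nu], so they commute and
    multiply as complex numbers do. *)
Lemma expqD nu (x y : R) : imaginary_unit nu ->
  (expq nu x * expq nu y)%quat = expq nu (x + y).
Proof.
case: nu => ? a b c [/= -> abc]; rewrite /expq /addq /scaleq /mulq /=.
rewrite cosD sinD; move: (sin x) (sin y) (cos x) (cos y) => sx sy cx cy.
have ss : sx * sy = sx * sy * (a ^+ 2 + b ^+ 2 + c ^+ 2) by rewrite abc mulr1.
by congr Quat; [rewrite [in RHS]ss; ring|ring|ring|ring].
Qed.

Lemma conjq_expq nu (x : R) : imaginary_unit nu -> conjq (expq nu x) = expq nu (- x).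
Proof.
case: nu => ? a b c [/= -> abc]; rewrite /expq /addq /scaleq /conjq /=.
by rewrite cosN sinN; congr Quat; ring.
Qed.

Lemma normq_scale_expq nu (r x : R) : imaginary_unit nu -> 0 <= r ->
  normq (scaleq r (expq nu x)) = r.
Proof.
case: nu => ? a b c [/= -> abc] r0; rewrite /normq /expq /addq /scaleq /=.
rewrite -[RHS](ger0_norm r0) -sqrtr_sqr; congr Num.sqrt.
have := cos2Dsin2 x; move: (sin x) (cos x) => sx cx cs.
have ss : sx ^+ 2 = sx ^+ 2 * (a ^+ 2 + b ^+ 2 + c ^+ 2) by rewrite abc mulr1.
have rr : r ^+ 2 = r ^+ 2 * (cx ^+ 2 + sx ^+ 2) by rewrite cs mulr1.
by rewrite [RHS]rr ss; ring.
Qed.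

Lemma invq_sqrt_mu2pi nu (b : R) : imaginary_unit nu -> b != 0 ->
  invq (sqrt_mu2pi nu b) =
  scaleq (Num.sqrt (2 * pi * `|b|))^-1 (expq nu (- (Num.sg b * (pi / 4)))).
Proof.
move=> nuP b0; have r0 : 0 < Num.sqrt (2 * pi * `|b|).
  by rewrite sqrtr_gt0 !mulr_gt0 ?pi_gt0 ?normr_gt0.
rewrite /invq /sqrt_mu2pi normq_scale_expq ?(ltW r0)// -conjq_expq//.
move: (expq _ _) => q; move: (Num.sqrt _) r0 => r r0.
have rE : r ^- 2 * r = r^-1 by field; rewrite gt_eqF.
by rewrite /scaleq /conjq /= -!mulrN !mulrA rE.
Qed.

Lemma lct_kernel_expq nu A (x y : R) : imaginary_unit nu -> A 0 1 != 0 ->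
  lct_kernel nu A x y = scaleq (Num.sqrt (2 * pi * `|A 0 1|))^-1
    (expq nu (A 0 0 / (2 * A 0 1) * x ^+ 2 - (A 0 1)^-1 * x * y +
              A 1 1 / (2 * A 0 1) * y ^+ 2 - Num.sg (A 0 1) * (pi / 4))).
Proof.
move=> nuP b0; rewrite /lct_kernel invq_sqrt_mu2pi//.
set psi := _ + _ * y ^+ 2; rewrite [psi - _]addrC -(expqD (- _) psi nuP).
move: (expq nu psi) (expq nu (- _)) ((Num.sqrt _)^-1) => p q r.
by rewrite /scaleq /mulq /=; congr Quat; ring.
Qed.

Lemma lct_kernel_chirpq nu A (x y : R) : imaginary_unit nu -> 0 < A 0 1 ->
  lct_kernel nu A x y =
  chirpq nu (A 0 0 / (2 * A 0 1)) (A 0 1)^-1 (A 1 1 / (2 * A 0 1)) (- (pi / 4))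
    (Num.sqrt (2 * pi * A 0 1))^-1 x y.
Proof.
move=> nuP b0; rewrite lct_kernel_expq ?gt_eqF// gtr0_sg// mul1r gtr0_norm//.
rewrite /chirpq /chirp_cos /chirp_sin /chirp_phase /expq /addq /scaleq /=.
by congr Quat; ring.
Qed.

Lemma invmx2_det1 A : \det A = 1 ->
  [/\ invmx A 0 0 = A 1 1, invmx A 0 1 = - A 0 1 & invmx A 1 1 = A 0 0].
Proof.
move=> dA; have uA : A \in unitmx by rewrite unitmxE dA unitr1.
have l0 : lift 0 0 = 1 :> 'I_2 by exact: val_inj.
have l1 : lift 1 0 = 0 :> 'I_2 by exact: val_inj.
rewrite /invmx uA dA invr1 scale1r; split; rewrite !mxE /cofactor det_mx11 !mxE ?l0 ?l1.
- by rewrite expr0 mul1r.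
- by rewrite expr1 mulN1r.
- by rewrite sqrrN expr1n mul1r.
Qed.

(** Inverting a matrix of determinant 1 exchanges the diagonal entries and
    negates [A 0 1]; this negates the phase and leaves the modulus of the
    kernel unchanged. *)
Lemma lct_kernel_invmx nu A (x y : R) : imaginary_unit nu -> \det A = 1 ->
  0 < A 0 1 -> lct_kernel nu (invmx A) y x = conjq (lct_kernel nu A x y).
Proof.
move=> nuP dA b0; have [E00 E01 E11] := invmx2_det1 dA.
rewrite !lct_kernel_expq ?E01 ?oppr_eq0 ?gt_eqF// E00 E11 normrN sgrN.
have -> (r : R) q : conjq (scaleq r q) = scaleq r (conjq q).
  by rewrite /conjq /scaleq /= !mulrN.
rewrite conjq_expq//; congr scaleq; congr expq.
by rewrite (gtr0_sg b0); move: (pi : R) => p; field; rewrite gt_eqF.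
Qed.

End LCTKernelShape.

Section LCTInversionPair.
Variable R : realType.
Local Notation mu := (@lebesgue_measure R).
Implicit Types (nu : quaternion R) (A : 'M[R]_2).

Lemma bounded_lct_kernel nu A : imaginary_unit nu -> 0 < A 0 1 ->
  bounded_kernel (lct_kernel nu A).
Proof.
move=> nuP b0.
rewrite (_ : lct_kernel nu A = chirpq nu (A 0 0 / (2 * A 0 1)) (A 0 1)^-1
    (A 1 1 / (2 * A 0 1)) (- (pi / 4)) (Num.sqrt (2 * pi * A 0 1))^-1); last first.
  by apply/funext => x; apply/funext => u; exact: lct_kernel_chirpq.
by apply: bounded_kernel_chirpq; rewrite invr_gt0 sqrtr_gt0 !mulr_gt0 ?pi_gt0.
Qed.

Lemma lct_kernel_invE nu A : imaginary_unit nu -> \det A = 1 -> 0 < A 0 1 ->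
  lct_kernel nu (invmx A) = fun u x => conjq (lct_kernel nu A x u).
Proof.
by move=> nuP dA b0; apply/funext => u; apply/funext => x; exact: lct_kernel_invmx.
Qed.

Lemma bounded_lct_kernel_inv nu A : imaginary_unit nu -> \det A = 1 ->
  0 < A 0 1 -> bounded_kernel (lct_kernel nu (invmx A)).
Proof.
move=> nuP dA b0; rewrite lct_kernel_invE//.
exact: (bounded_kernel_conjq (bounded_lct_kernel nuP b0)).
Qed.

Lemma inversion_pair_lct nu A : nu = quat_i \/ nu = quat_j -> \det A = 1 ->
  0 < A 0 1 -> inversion_pair mu mu (lct_kernel nu A) (lct_kernel nu (invmx A)).
Proof.
move=> nuE dA b0.
have nuP : imaginary_unit nu.
  by case: nuE => ->; [exact: imaginary_unit_i|exact: imaginary_unit_j].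
rewrite lct_kernel_invE//.
rewrite (_ : lct_kernel nu A = chirpq nu (A 0 0 / (2 * A 0 1)) (A 0 1)^-1
    (A 1 1 / (2 * A 0 1)) (- (pi / 4)) (Num.sqrt (2 * pi * A 0 1))^-1); last first.
  by apply/funext => x; apply/funext => u; exact: lct_kernel_chirpq.
have b1 : 0 < (A 0 1)^-1 by rewrite invr_gt0.
have k0 : 0 < (Num.sqrt (2 * pi * A 0 1))^-1.
  by rewrite invr_gt0 sqrtr_gt0 !mulr_gt0 ?pi_gt0.
have kE : (Num.sqrt (2 * pi * A 0 1))^-1 ^+ 2 = (A 0 1)^-1 / (2 * pi).
  rewrite exprVn sqr_sqrtr; last by rewrite !mulr_ge0 ?pi_ge0// ltW.
  by rewrite invfM mulrC.
by case: nuE => ->; [exact: inversion_pair_chirpq_i|exact: inversion_pair_chirpq_j].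
Qed.

End LCTInversionPair.

(** * Replacing f by a Borel function *)

Section CompletedMeasurability.
Context d (T : measurableType d) (R : realType).
Variable m : {measure set T -> \bar R}.

(** It suffices to look at the preimages of the rays with rational endpoint:
    each is Borel up to a null set, and the union of these countably many
    null sets is null. *)
Lemma completed_measurable_off_null (g : T -> R) :
    (forall B : set (measurableTypeR R), measurable B ->
      completed_algebra_gen m (g @^-1` B)) ->
  exists N, [/\ measurable N, m N = 0%E & measurable_fun (~` N) g].
Proof.
move=> gm.
have H (q : rat) : exists A M, [/\ measurable A, measurable M, m M = 0%E &
    forall x, ~ M x -> (ratr q < g x) <-> A x].
  have [|A mA [N [M [mM M0 NM]] E]] := gm `]ratr q, +oo[%classic.
    exact: measurable_itv.
  exists A, M; split => // x nMx; have := congr1 (fun X => X x) E => /= Ex.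
  have -> : (ratr q < g x : Prop) = (A `|` N) x.
    by rewrite /setU/= Ex in_itv/= andbT.
  by split => [[//|/NM//]|]; left.
have /choice[A /choice[M HAM]] := H.
have [N [mN N0 subN]] : m.-negligible (\bigcup_n M (odflt 0 (unpickle n))).
  apply: negligible_bigcup => n.
  by have [_ mM M0 _] := HAM (odflt 0 (unpickle n)); apply/negligibleP.
have MN q : M q `<=` N.
  by move=> x Mx; apply: subN; exists (pickle q) => //=; rewrite pickleK.
exists N; split => //.
apply: (measurability _ (RGenOInfty.measurableE R)) => // _ [_ [r ->] <-].
rewrite [X in measurable X](_ : _ =
    \bigcup_q (if r < ratr q then ~` N `&` A q else set0)).
  apply: bigcupT_measurable_rat => q; case: ifP => // _.
  by apply: measurableI; [exact: measurableC|have [] := HAM q].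
apply/seteqP; split => [x /= [nNx]|x [q _ /=]].
  rewrite in_itv/= andbT => /rat_in_itvoo[q]; rewrite in_itv/= => /andP[rq qg].
  exists q => //=; rewrite rq; split => //.
  by have [_ _ _ /(_ x) <-//] := HAM q; move/MN.
case: ifP => // rq [nNx Aqx]; split => //=; rewrite in_itv/= andbT (lt_trans rq)//.
by have [_ _ _ /(_ x) ->//] := HAM q; move/MN.
Qed.

End CompletedMeasurability.

Section CutOff.
Context d (T : measurableType d) (R : realType).
Variable m : {measure set T -> \bar R}.
Implicit Types (f : T -> quaternion R) (N : set T).

Definition cut N f x : quaternion R := scaleq (\1_(~` N) x) (f x).

Lemma cut_out N f x : ~ N x -> cut N f x = f x.
Proof.
move=> Nx; rewrite /cut indicE mem_set//.
by case: (f x) => a b e h; rewrite /scaleq /= !mul1r.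
Qed.

Lemma cut_in N f x : N x -> cut N f x = Quat 0 0 0 0.
Proof.
move=> Nx; rewrite /cut indicE memNset; first by rewrite /scaleq !mul0r.
by apply.
Qed.

Lemma measurable_cut N f : measurable N ->
    [/\ measurable_fun (~` N) (fun x => qre (f x)), measurable_fun (~` N) (fun x => qi (f x)),
        measurable_fun (~` N) (fun x => qj (f x)) & measurable_fun (~` N) (fun x => qk (f x))] ->
  measurableq (cut N f).
Proof.
move=> mN [f1 f2 f3 f4].
have H (h : T -> R) : measurable_fun (~` N) h ->
    measurable_fun setT (fun x => \1_(~` N) x * h x).
  move=> /(measurable_restrictT _ (measurableC mN)); apply: eq_measurable_fun => x _.
  by rewrite patchE indicE; case: ifP => _ /=; rewrite ?mul1r ?mul0r.
by split; apply: H.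
Qed.

Lemma ae_cut N f : measurable N -> m N = 0%E -> {ae m, forall x, f x = cut N f x}.
Proof.
move=> mN N0; exists N; split => // x /= h; apply: contrapT => Nx.
by apply: h; rewrite cut_out.
Qed.

Lemma integrableq_normq f : measurableq f ->
  (\int[m]_x (normq (f x))%:E < +oo)%E -> integrableq m f.
Proof.
move=> mf fi; have [f1 f2 f3 f4] := mf.
have mn : measurable_fun setT (fun x => normq (f x)).
  apply: measurableT_comp.
    by apply: continuous_measurable_fun; exact: sqrt_continuous.
  by rewrite /=; do ?apply: measurable_funD; apply: measurable_funX.
have H (h : T -> R) : measurable_fun setT h -> (forall x, `|h x| <= normq (f x)) ->
    m.-integrable setT (EFin \o h).
  move=> mh hn; apply/integrableP; split; first exact/measurable_EFinP.
  apply: le_lt_trans fi; apply: ge0_le_integral => //.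
  - by apply: measurableT_comp => //; exact/measurable_EFinP.
  - exact/measurable_EFinP.
  - by move=> x _; rewrite lee_fin.
by split; apply: H => // x; case: (le_normq (f x)).
Qed.

End CutOff.

Section BorelVersion.
Variable R : realType.
Local Notation mu := (@lebesgue_measure R).

(** Two null sets are cut away: one to reach Borel measurability, and then the
    union of the horizontal lines on which the section is not integrable. *)
Lemma borel_version (f : R * R -> quaternion R) : L1q f ->
  exists g : R * R -> quaternion R,
    [/\ {ae (mu \x mu)%E, forall p, f p = g p}, integrableq (mu \x mu)%E g &
        forall t, integrableq mu (fun s => g (s, t))].
Proof.
move=> [[f1 f2 f3 f4] fi].
have [N1 [mN1 N10 h1]] := completed_measurable_off_null f1.
have [N2 [mN2 N20 h2]] := completed_measurable_off_null f2.
have [N3 [mN3 N30 h3]] := completed_measurable_off_null f3.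
have [N4 [mN4 N40 h4]] := completed_measurable_off_null f4.
have U (X Y : set (measurableTypeR R * measurableTypeR R)) :
    measurable X /\ leb2 X = 0%E -> measurable Y /\ leb2 Y = 0%E ->
    measurable (X `|` Y) /\ leb2 (X `|` Y) = 0%E.
  by move=> [mX X0] [mY Y0]; split; [exact: measurableU|exact: null_set_setU].
pose N := N1 `|` N2 `|` (N3 `|` N4).
have [mN N0] := U _ _ (U _ _ (conj mN1 N10) (conj mN2 N20))
                      (U _ _ (conj mN3 N30) (conj mN4 N40)).
rewrite -/N in mN N0.
pose g := cut N f.
have mg : measurableq g.
  apply: measurable_cut => //; split.
  - by apply: measurable_funS h1; [exact: measurableC|move=> x nN N1x; apply: nN; left; left].
  - by apply: measurable_funS h2; [exact: measurableC|move=> x nN N1x; apply: nN; left; right].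
  - by apply: measurable_funS h3; [exact: measurableC|move=> x nN N1x; apply: nN; right; left].
  - by apply: measurable_funS h4; [exact: measurableC|move=> x nN N1x; apply: nN; right; right].
have ig : integrableq (mu \x mu)%E g.
  apply: integrableq_normq => //; apply: le_lt_trans fi; rewrite le_eqVlt.
  apply/orP; left; apply/eqP; apply: (integral_off_null mN N0) => p Np.
  by rewrite /g cut_out.
have [M [mM M0 subM]] := ae_integrableq1 ig.
pose N' : set (measurableTypeR R * measurableTypeR R) := setT `*` M.
have mN' : measurable N' by exact: measurableX.
(* The product of a null set with the whole line is null. *)
have N'0 : leb2 N' = 0%E.
  transitivity (mu setT * mu M)%E; first exact: product_measure1E.
  by rewrite M0 mule0.
have mg' : measurableq (cut N' g).
  by have [g1 g2 g3 g4] := mg; apply: measurable_cut => //; split; exact: measurable_funTS.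
have aef := @ae_cut _ _ R leb2 N f mN N0.
have aeg := @ae_cut _ _ R leb2 N' g mN' N'0.
exists (cut N' g); split.
- by apply: ae_imply2 aef aeg => p ->.
- exact: ae_integrableq aeg ig mg'.
- move=> t; have [Mt|Mt] := pselect (M t).
    rewrite (_ : (fun s => _) = fun=> Quat 0 0 0 0); first by split; exact: integrable0.
    by apply/funext => s; rewrite cut_in.
  rewrite (_ : (fun s => _) = fun s => g (s, t)); last first.
    by apply/funext => s; rewrite cut_out// => -[].
  by apply: contrapT => h; apply: Mt; apply: subM.
Qed.

End BorelVersion.

(** * The inversion theorem *)

Theorem theorem3p13 (R : realType) (A1 A2 : 'M[R]_2)
  (detA1 : \det A1 = 1) (detA2 : \det A2 = 1)
  (b1_gt0 : 0 < A1 0 1) (b2_gt0 : 0 < A2 0 1)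
  (f : R * R -> quaternion R)
  (f_L1 : L1q f) (Lf_L1 : L1q (right_qlct A1 A2 f)) :
  \forall p \ae (@leb2 R),
    f p = integralq (fun w => right_qlct A1 A2 f w
                              * lct_kernel quat_j (invmx A2) w.2 p.2
                              * lct_kernel quat_i (invmx A1) w.1 p.1)%quat.
Proof.
have [g [fg ig g_sec]] := borel_version f_L1.
pose F := transform2 (@lebesgue_measure R) (@lebesgue_measure R)
  (lct_kernel quat_i A1) (lct_kernel quat_j A2) g.
have FE : right_qlct A1 A2 f = F.
  apply/funext => w; rewrite /F /transform2 -/(intq _ _).
  by apply: (@ae_intq _ _ _ leb2); apply: ae_imply fg => p ->.
have ui := imaginary_unit_i R; have uj := imaginary_unit_j R.
pose bounded := @bounded_kernel _ _ (measurableTypeR R) (measurableTypeR R) R.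
have bK1 : bounded (lct_kernel quat_i A1) := bounded_lct_kernel ui b1_gt0.
have bK2 : bounded (lct_kernel quat_j A2) := bounded_lct_kernel uj b2_gt0.
have bK1' : bounded (lct_kernel quat_i (invmx A1)) := bounded_lct_kernel_inv ui detA1 b1_gt0.
have bK2' : bounded (lct_kernel quat_j (invmx A2)) := bounded_lct_kernel_inv uj detA2 b2_gt0.
have iF : integrableq leb2 F.
  apply: (@integrableq_normq _ _ R leb2); last by rewrite -FE; case: Lf_L1.
  exact: (measurable_transform2 bK1 bK2 ig).
have := iterated_inversion bK1 bK1' bK2 bK2'
  (inversion_pair_lct (or_introl erefl) detA1 b1_gt0)
  (inversion_pair_lct (or_intror erefl) detA2 b2_gt0) ig g_sec iF.
rewrite FE; apply: ae_imply2 fg => p -> ->.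
by [].
Qed.
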